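(* Assume the standing hypotheses of the context. Let $u$ be an extremizer (a minimizer or a maximizer) of $$\mathcal{J}[u]=\int_{\Delta_n}F\big(t,u(t),\nabla^{\boldsymbol\alpha}_{B_{P^1}}u(t),\nabla^{\boldsymbol\beta}_{K_{P^2}}u(t)\big)\,dt_n\cdots dt_1$$ among all admissible functions (for a given boundary datum $\psi:\partial\Delta_n\to\mathbb{R}^N$), and suppose $u$ satisfies the regularity hypotheses (R) of the context. Then for each $k=1,\dots,N$ and all $t\in\Delta_n$, $$\sum_{i=1}^n\Big[-A^{\alpha_i}_{P^{1*}_{t_i}}\Big(\partial_{v_{k,i}}F\{u\}(t)\Big)+K^{\beta_i}_{P^{2*}_{t_i}}\Big(\partial_{w_{k,i}}F\{u\}(t)\Big)\Big]+\partial_{x_k}F\{u\}(t)=0,$$ where the operators act on the functions $t\mapsto\partial_{v_{k,i}}F\{u\}(t)$ and $t\mapsto\partial_{w_{k,i}}F\{u\}(t)$.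
   Context: Fix $n,N\in\mathbb{N}$, real numbers $a_i<b_i$, $\Delta_n=(a_1,b_1)\times\cdots\times(a_n,b_n)$ with closure $\bar\Delta_n$, $t=(t_1,\dots,t_n)$, $dt=dt_n\cdots dt_1$. For each order $\gamma\in(0,1)$ a kernel $k_\gamma$ is given, assumed to be a difference kernel: $k_\gamma(s,\tau)=k_\gamma(s-\tau)$. A parameter set is $P_{t_i}=\langle a_i,t_i,b_i,p_i,q_i\rangle$ ($p_i,q_i\in\mathbb{R}$), with dual $P^*_{t_i}=\langle a_i,t_i,b_i,q_i,p_i\rangle$. For $f:\bar\Delta_n\to\mathbb{R}$: $K^{\gamma}_{P_{t_i}}f(t)=p_i\int_{a_i}^{t_i}k_\gamma(t_i-\tau)f(t_1,\dots,\tau,\dots,t_n)d\tau+q_i\int_{t_i}^{b_i}k_\gamma(\tau-t_i)f(t_1,\dots,\tau,\dots,t_n)d\tau$ ($\tau$ in the $i$-th slot); $A^{\alpha}_{P_{t_i}}f=\frac{\partial}{\partial t_i}K^{1-\alpha}_{P_{t_i}}f$; $B^{\alpha}_{P_{t_i}}f=K^{1-\alpha}_{P_{t_i}}\frac{\partial f}{\partial t_i}$; operators act componentwise on vector functions. Standing data: $\boldsymbol\alpha=(\alpha_1,\dots,\alpha_n)$, $\boldsymbol\beta=(\beta_1,\dots,\beta_n)\in(0,1)^n$; $P^j=(P^j_{t_1},\dots,P^j_{t_n})$ with $P^j_{t_i}=\langle a_i,t_i,b_i,p^j_i,q^j_i\rangle$, $j=1,2$; $k_{1-\alpha_i},k_{\beta_i}\in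 L_1((0,b_i-a_i);\mathbb{R})$. For $u=(u_1,\dots,u_N):\bar\Delta_n\to\mathbb{R}^N$, $\nabla^{\boldsymbol\alpha}_{B_{P^1}}u$ is the $N\times n$ array with entries $B^{\alpha_i}_{P^1_{t_i}}u_k$ and $\nabla^{\boldsymbol\beta}_{K_{P^2}}u$ the array with entries $K^{\beta_i}_{P^2_{t_i}}u_k$. The Lagrangian $F(t,x,v,w)$, $t\in\bar\Delta_n$, $x\in\mathbb{R}^N$, $v=(v_{k,i}),w=(w_{k,i})\in\mathbb{R}^{N\times n}$, is of class $C^2$; $\partial_{x_k}F,\partial_{v_{k,i}}F,\partial_{w_{k,i}}F$ are its partial derivatives, and $F\{u\}(t)$ denotes evaluation at $(t,u(t),\nabla^{\boldsymbol\alpha}_{B_{P^1}}u(t),\nabla^{\boldsymbol\beta}_{K_{P^2}}u(t))$. A function $u\in C^1(\bar\Delta_n;\mathbb{R}^N)$ is admissible if all $B^{\alpha_i}_{P^1_{t_i}}u$ and $K^{\beta_i}_{P^2_{t_i}}u$ exist and are continuous on $\bar\Delta_n$ and $u=\psi$ on $\partial\Delta_n$. (R): for all $i,k$, $K^{1-\alpha_i}_{P^{1*}_{t_i}}\big(\partial_{v_{k,i}}F\{u\}\big)\in C^1(\bar\Delta_n)$ (so $A^{\alpha_i}_{P^{1*}_{t_i}}(\partial_{v_{k,i}}F\{u\})$ is continuous) and $K^{\beta_i}_{P^{2*}_{t_i}}\big(\partial_{w_{k,i}}F\{u\}\big)$ is continuous on $\bar\Delta_n$. *)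

(* Defs.v *)
From HB Require Import structures.
From mathcomp Require Import all_boot all_order all_algebra.
From mathcomp Require Import all_classical all_reals all_analysis.
Set Implicit Arguments.
Unset Strict Implicit.
Unset Printing Implicit Defensive.
Import Order.TTheory GRing.Theory Num.Theory.
Import numFieldNormedType.Exports.
Local Open Scope classical_set_scope.
Local Open Scope ring_scope.

Section FracVar.
Context {R : realType}.

(** * Directional derivatives taken within a set D (one-sided at the
    boundary when needed): the limit of the difference quotient
    h^-1 (f (z + h e) - f z) as h -> 0, h <> 0, z + h e in D. *)
Definition dquot {V W : normedModType R} (f : V -> W) (z e : V) (h : R) : W :=
  h^-1 *: (f (z + h *: e) - f z).

Definition dfilter {V : normedModType R} (D : set V) (z e : V) :=
  within [set h : R | h != 0 /\ D (z + h *: e)] (nbhs (0 : R)).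

Definition dderivable_within {V W : normedModType R} (D : set V)
  (f : V -> W) (z e : V) : Prop :=
  cvg (dquot f z e @ dfilter D z e).

Definition dderiv_within {V W : normedModType R} (D : set V)
  (f : V -> W) (z e : V) : W :=
  lim (dquot f z e @ dfilter D z e).

Definition C1_on {V W : normedModType R} (D : set V) (E : set V)
  (f : V -> W) : Prop :=
  {within D, continuous f} /\
  (forall e, E e ->
     (forall z, D z -> dderivable_within D f z e) /\
     {within D, continuous (fun z => dderiv_within D f z e)}).

Definition C2_on {V W : normedModType R} (D : set V) (E : set V)
  (f : V -> W) : Prop :=
  C1_on D E f /\
  (forall e, E e -> C1_on D E (fun z => dderiv_within D f z e)).

Variables (n N : nat).

Definition cbox (a b : 'rV[R]_n) : set 'rV[R]_n :=
  [set t | forall i, a 0 i <= t 0 i <= b 0 i].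
Definition obox (a b : 'rV[R]_n) : set 'rV[R]_n :=
  [set t | forall i, a 0 i < t 0 i < b 0 i].

Definition ebasis (i : 'I_n) : 'rV[R]_n := delta_mx 0 i.
Definition tdirs : set 'rV[R]_n := [set ebasis i | i in setT].

Definition upd (t : 'rV[R]_n) (i : 'I_n) (s : R) : 'rV[R]_n :=
  \row_j (if j == i then s else t 0 j).

Definition tpartial (a b : 'rV[R]_n) (i : 'I_n) (f : 'rV[R]_n -> R) :
  'rV[R]_n -> R :=
  fun t => dderiv_within (cbox a b) f t (ebasis i).

(** K^gamma_{P_{t_i}} f, with difference kernel kg = k_gamma and
    P_{t_i} = <a_i, t_i, b_i, p, q>; Lebesgue integrals. *)
Definition Kop (kg : R -> R) (a b : 'rV[R]_n) (i : 'I_n) (p q : R)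
  (f : 'rV[R]_n -> R) : 'rV[R]_n -> R :=
  fun t =>
    p * (\int[lebesgue_measure]_(tau in `[a 0 i, t 0 i])
            (kg (t 0 i - tau) * f (upd t i tau)))
  + q * (\int[lebesgue_measure]_(tau in `[t 0 i, b 0 i])
            (kg (tau - t 0 i) * f (upd t i tau))).

(** A^alpha_P f = d/dt_i K^{1-alpha}_P f   (here kg = k_{1-alpha}) *)
Definition Aop (kg : R -> R) (a b : 'rV[R]_n) (i : 'I_n) (p q : R)
  (f : 'rV[R]_n -> R) : 'rV[R]_n -> R :=
  tpartial a b i (Kop kg a b i p q f).

(** B^alpha_P f = K^{1-alpha}_P (d f/dt_i)   (here kg = k_{1-alpha}) *)
Definition Bop (kg : R -> R) (a b : 'rV[R]_n) (i : 'I_n) (p q : R)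
  (f : 'rV[R]_n -> R) : 'rV[R]_n -> R :=
  Kop kg a b i p q (tpartial a b i f).

Definition comp (k : 'I_N) (u : 'rV[R]_n -> 'rV[R]_N) : 'rV[R]_n -> R :=
  fun t => u t 0 k.

(** iterated integral  \int_{a_1}^{b_1} ... \int_{a_n}^{b_n} G dt_n ... dt_1 *)
Definition iint (a b : 'rV[R]_n) (G : 'rV[R]_n -> R) : R :=
  foldr (fun i (H : 'rV[R]_n -> R) t =>
           \int[lebesgue_measure]_(s in `[a 0 i, b 0 i]) H (upd t i s))
        G (enum 'I_n) 0.

Definition LagT : Type :=
  ('rV[R]_n * 'rV[R]_N * 'M[R]_(N, n) * 'M[R]_(N, n))%type.

Definition LagDom (a b : 'rV[R]_n) : set LagT :=
  [set z | cbox a b z.1.1.1].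

Definition dir_t (i : 'I_n) : LagT := (ebasis i, 0, 0, 0).
Definition dir_x (k : 'I_N) : LagT := (0, delta_mx 0 k, 0, 0).
Definition dir_v (k : 'I_N) (i : 'I_n) : LagT := (0, 0, delta_mx k i, 0).
Definition dir_w (k : 'I_N) (i : 'I_n) : LagT := (0, 0, 0, delta_mx k i).

Definition Lagdirs : set LagT :=
  [set e | (exists i, e = dir_t i) \/ (exists k, e = dir_x k) \/
           (exists k i, e = dir_v k i) \/ (exists k i, e = dir_w k i)].

Definition gradB (kern : R -> R -> R) (a b alpha p1 q1 : 'rV[R]_n)
  (u : 'rV[R]_n -> 'rV[R]_N) (t : 'rV[R]_n) : 'M[R]_(N, n) :=
  \matrix_(k, i) Bop (kern (1 - alpha 0 i)) a b i (p1 0 i) (q1 0 i) (comp k u) t.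

Definition gradK (kern : R -> R -> R) (a b beta p2 q2 : 'rV[R]_n)
  (u : 'rV[R]_n -> 'rV[R]_N) (t : 'rV[R]_n) : 'M[R]_(N, n) :=
  \matrix_(k, i) Kop (kern (beta 0 i)) a b i (p2 0 i) (q2 0 i) (comp k u) t.

Definition Feval (F : LagT -> R) (kern : R -> R -> R)
  (a b alpha beta p1 q1 p2 q2 : 'rV[R]_n) (u : 'rV[R]_n -> 'rV[R]_N)
  (t : 'rV[R]_n) : LagT :=
  (t, u t, gradB kern a b alpha p1 q1 u t, gradK kern a b beta p2 q2 u t).

Definition Jfun (F : LagT -> R) (kern : R -> R -> R)
  (a b alpha beta p1 q1 p2 q2 : 'rV[R]_n) (u : 'rV[R]_n -> 'rV[R]_N) : R :=
  iint a b (fun t => F (Feval F kern a b alpha beta p1 q1 p2 q2 u t)).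

Definition admissible (kern : R -> R -> R)
  (a b alpha beta p1 q1 p2 q2 : 'rV[R]_n) (psi : 'rV[R]_n -> 'rV[R]_N)
  (u : 'rV[R]_n -> 'rV[R]_N) : Prop :=
  C1_on (cbox a b) tdirs u /\
  (forall k i, {within cbox a b, continuous
     Bop (kern (1 - alpha 0 i)) a b i (p1 0 i) (q1 0 i) (comp k u)}) /\
  (forall k i, {within cbox a b, continuous
     Kop (kern (beta 0 i)) a b i (p2 0 i) (q2 0 i) (comp k u)}) /\
  (forall t, cbox a b t -> ~ obox a b t -> u t = psi t).

Definition dxF (a b : 'rV[R]_n) (F : LagT -> R) (k : 'I_N) (z : LagT) : R :=
  dderiv_within (LagDom a b) F z (dir_x k).
Definition dvF (a b : 'rV[R]_n) (F : LagT -> R) (k : 'I_N) (i : 'I_n)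
  (z : LagT) : R :=
  dderiv_within (LagDom a b) F z (dir_v k i).
Definition dwF (a b : 'rV[R]_n) (F : LagT -> R) (k : 'I_N) (i : 'I_n)
  (z : LagT) : R :=
  dderiv_within (LagDom a b) F z (dir_w k i).

End FracVar.

(* Main.v *)
Require Import Defs.
From HB Require Import structures.
From mathcomp Require Import all_boot all_order all_algebra.
From mathcomp Require Import ring lra.
From mathcomp Require Import all_classical all_reals all_analysis.
From mathcomp Require Import measurable_realfun.
Import Order.TTheory GRing.Theory Num.Theory.
Import numFieldNormedType.Exports.
Local Open Scope classical_set_scope.
Local Open Scope ring_scope.

(** Perturb the k-th component of u by eps * eta, where eta is a C^1 bump
    supported in a small ball of the open box.  Since the kernels are integrable,
    K eta and B eta are convolutions of eta and its derivatives with L^1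
    functions, hence continuous, so the perturbed function is admissible.  The
    derivatives of F are uniformly continuous near the compact image of the box,
    so J is differentiable in eps at 0, and extremality makes
    int (F_x eta + sum_i (F_{v_i} B_i eta + F_{w_i} K_i eta)) vanish.  Moving the
    i-th integral innermost, Fubini's theorem replaces K_P acting on eta by
    K_{P^*} acting on the derivative of F, and an integration by parts in t_i
    turns B_i into -A_i.  The integral becomes int eta * E, with E the continuous
    left-hand side of the equation, and E must vanish wherever eta can be
    centred. *)

(** * Lebesgue integrals on the line *)

(** Three obstacles shape the proof. Continuity and derivatives are given only within the closed
    box, whereas Fubini's theorem and integration by parts are applied to functions on whole lines;
    composing with a retraction onto the box bridges the gap. The kernels are merely integrable, and
    the limits of integration move with t; extending a kernel by zero turns K_P into an integral
    over a fixed interval, and for a bump into a convolution in which t enters through the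
    continuous factor alone. Finally, F comes with derivatives along coordinate directions, so its
    increment is expanded one coordinate at a time, with an error uniform in t; a sup bound then
    carries that error through the iterated integral. No measure on R^n appears: the integrals are
    one-dimensional and are exchanged two at a time. The bump is the square of the positive part of
    r^2 - |t - c|^2, so that its difference quotients are controlled by polynomial inequalities. *)

Section OneDimIntegrals.
Context {R : realType}.
Notation mu := (@lebesgue_measure R).

(** The product sigma-algebra is generated by rectangles, so an open set is reached through a
    countable cover: the squares with rational centre and radius that it contains. *)
Lemma open_measurable_prodR (U : set (R * R)) : open U -> measurable U.
Proof.
move=> oU.
pose sq (q : rat * rat * rat) : set (R * R) :=
  ball (ratr q.1.1 : R) (ratr q.2) `*` ball (ratr q.1.2 : R) (ratr q.2).
pose S q := if `[< sq q `<=` U >] then sq q else set0.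
have -> : U = \bigcup_q S q.
  apply/seteqP; split=> [[x y] Uxy|z [q _]]; last first.
    by rewrite /S; case: asboolP => // h /h.
  have [e /= e0 he] : exists2 e : R, 0 < e & ball (x, y) e `<=` U.
    by have /nbhs_ballP[e e0 he] := open_nbhs_nbhs (conj oU Uxy); exists e.
  have e20 : 0 < e / 2 by rewrite divr_gt0.
  (* A square of radius below e / 2 that contains (x, y) lies in the ball of radius e, by the
     triangle inequality in each coordinate. *)
  have [r] := rat_in_itvoo e20; rewrite in_itv /= => /andP[r0 re].
  have ratr_near (v : R) : exists p, `|ratr p - v| < ratr r.
    have : v - ratr r < v + ratr r by lra.
    by case/rat_in_itvoo => p; rewrite in_itv/= -ltr_distl; exists p.
  have [p hp] := ratr_near x; have [q hq] := ratr_near y.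
  exists (p, q, r) => //; rewrite /S; case: asboolP => [_//|[]].
  move=> [z1 z2] [/= h1 h2]; apply: he; split => /=.
    rewrite -ball_normE /ball_ /= in h1 *.
    by rewrite (le_lt_trans (ler_distD (ratr p) _ _))// (distrC x); lra.
  rewrite -ball_normE /ball_ /= in h2 *.
  by rewrite (le_lt_trans (ler_distD (ratr q) _ _))// (distrC y); lra.
apply: countable_bigcupT_measurable => // q; rewrite /S; case: asboolP => // _.
by apply: measurableX; exact: measurable_ball.
Qed.

Lemma continuous_measurable_prodR (G : R * R -> R) :
  continuous G -> measurable_fun setT G.
Proof.
move=> /continuousP cG.
apply: (measurability _ (RGenOInfty.measurableE R)) => _ [_ [x ->] <-].
by rewrite setTI; apply: open_measurable_prodR; apply: cG; exact: interval_open.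
Qed.

Definition flip (x : R) : measurableTypeR R -> measurableTypeR R :=
  fun y => x - y.

Lemma reflect_measurable (x : R) : measurable_fun setT (flip x).
Proof. by apply: measurable_funB => //; exact: measurable_cst. Qed.

HB.instance Definition _ (x : R) :=
  isMeasurableFun.Build _ _ _ _ (flip x) (reflect_measurable x).

(** Lebesgue measure is determined by its values on half-open intervals, and a reflection only moves
    the closed end of such an interval to the other side. *)
Lemma lebesgue_measure_reflect (x : R) (A : set R) : measurable A ->
  pushforward mu (flip x) A = mu A.
Proof.
move=> mA; apply/esym/lebesgue_measure_unique => //= _ [[c d]] _ <-.
rewrite /pushforward.
have -> : flip x @^-1` `]c, d]%classic = `[x - d, x - c[%classic.
  apply/seteqP; split => y /=; rewrite /flip !in_itv/= => /andP[h1 h2];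
   apply/andP; split; lra.
rewrite !lebesgue_measure_itv/= !lte_fin ltrD2l ltrN2 -!EFinB.
by congr (if _ then _ else _); congr EFin; lra.
Qed.

Lemma ge0_integral_reflect (x : R) (f : R -> \bar R) :
  measurable_fun setT f -> (forall y, 0 <= f y)%E ->
  (\int[mu]_y f (x - y)%R = \int[mu]_y f y)%E.
Proof.
move=> mf f0.
have -> : (\int[mu]_y f (x - y)%R = \int[pushforward mu (flip x)]_y f y)%E.
  by rewrite ge0_integral_pushforward//= ?preimage_setT//; exact: reflect_measurable.
by apply: eq_measure_integral => //= A mA _; exact: lebesgue_measure_reflect.
Qed.

Lemma integrable_reflect (x : R) (f : R -> \bar R) :
  mu.-integrable setT f -> mu.-integrable setT (fun y => f (x - y)).
Proof.
move=> /integrableP[mf fi]; apply/integrableP; split.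
  by apply: (measurableT_comp mf (reflect_measurable x)).
rewrite (ge0_integral_reflect x (abse \o f))//.
  by apply: measurableT_comp => //; exact: mf.
by move=> y; exact: abse_ge0.
Qed.

Lemma integral_reflect (x : R) (f : R -> \bar R) :
  mu.-integrable setT f ->
  (\int[mu]_y f (x - y)%R = \int[mu]_y f y)%E.
Proof.
move=> /integrableP[mf _]; rewrite integralE [RHS]integralE.
congr (_ - _)%E.
  rewrite -(ge0_integral_reflect x (f^\+)%E); last 2 first.
    by apply: measurable_funepos; exact: mf.
    by move=> y; exact: funepos_ge0.
  by apply: eq_integral => y _; rewrite (funepos_comp f (flip x)).
rewrite -(ge0_integral_reflect x (f^\-)%E); last 2 first.
  by apply: measurable_funeneg; exact: mf.
  by move=> y; exact: funeneg_ge0.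
by apply: eq_integral => y _; rewrite (funeneg_comp f (flip x)).
Qed.

Lemma continuous_bounded_itv (c d : R) (h : R -> R) : continuous h ->
  exists2 M : R, 0 <= M & forall y, y \in `[c, d] -> `|h y| <= M.
Proof.
move=> ch; have [cd|dc] := leP c d; last first.
  by exists 0 => // y; rewrite in_itv/= => /andP[h1 h2]; lra.
have cn : {within `[c, d], continuous (fun y => `|h y|)}.
  apply: continuous_subspaceT => y.
  by apply: continuous_comp; [exact: ch|exact: norm_continuous].
have [e _ he] := EVT_max cd cn.
by exists (`|h e|).
Qed.

Lemma continuous_integrable (c d : R) (h : R -> R) : continuous h ->
  mu.-integrable `[c, d] (EFin \o h).
Proof.
move=> ch; apply: continuous_compact_integrable; first exact: segment_compact.
exact: continuous_subspaceT.
Qed.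

Lemma integrableM_continuous (c d : R) (w h : R -> R) :
  mu.-integrable `[c, d] (EFin \o w) -> continuous h ->
  mu.-integrable `[c, d] (EFin \o (fun y => w y * h y)).
Proof.
move=> wi ch; have [M M0 hM] := continuous_bounded_itv c d _ ch.
apply: (@integrableMl _ _ _ mu `[c, d]%classic _ (EFin \o w) h) => //.
  by apply: measurable_funTS; exact: continuous_measurable_fun.
exists M; split; rewrite ?num_real// => N MN y /= cy.
by rewrite (le_trans (hM y cy))// ltW.
Qed.
End OneDimIntegrals.

(** * Parameter integrals and Fubini's theorem *)

Section ParamIntegrals.
Context {R : realType}.
Notation mu := (@lebesgue_measure R).

Lemma continuous_pair (S T U : topologicalType) (f : S -> T) (g : S -> U) :
  continuous f -> continuous g -> continuous (fun x => (f x, g x)).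
Proof.
move=> cf cg x; exact: (@cvg_pair _ _ _ _ (nbhs (f x)) (nbhs (g x)) _ _ _
  f g (cf x) (cg x)).
Qed.

Lemma continuous_pair_r (T U : topologicalType) (t : T) :
  continuous (fun s : U => (t, s)).
Proof. by apply: continuous_pair => s; [exact: cvg_cst|exact: cvg_id]. Qed.

Lemma continuous_pair_l (T U : topologicalType) (s : U) :
  continuous (fun t : T => (t, s)).
Proof. by apply: continuous_pair => t; [exact: cvg_id|exact: cvg_cst]. Qed.

(** Compactness of the segment makes the neighbourhood of t0 independent of s. As T is only a
    topological space, the argument is a tube lemma rather than uniform continuity. *)
Lemma near_uniform_itv (T : topologicalType) (H : T -> R -> R) (c d : R)
    (t0 : T) (e : R) : 0 < e ->
  continuous (fun z : T * R => H z.1 z.2) ->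
  \forall t \near t0, forall s, s \in `[c, d] -> `|H t s - H t0 s| <= e.
Proof.
move=> e0 cH; have /compact_near_coveringP := @segment_compact R c d.
move=> /(_ T (nbhs t0) (fun t s => `|H t s - H t0 s| <= e) _) h.
suff : \forall t \near nbhs t0,
  [set` `[c, d]] `<=` (fun s => `|H t s - H t0 s| <= e) by [].
apply: h => s _; have e20 : 0 < e / 2 by rewrite divr_gt0.
have := cH (t0, s) => /cvgrPdist_lt /(_ _ e20) [[A B] /= [hA hB] AB].
exists (B, A) => // -[s' t'] /= [Bs' At'].
have h1 := AB (t', s') (conj At' Bs').
have h2 := AB (t0, s') (conj (nbhs_singleton hA) Bs').
rewrite /= distrC in h1; rewrite /= in h2.
by rewrite (le_trans (ler_distD (H t0 s) _ _))//; lra.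
Qed.

(** The weight is only integrable: the increment is at most the L^1 norm of w times the supremum
    over s of [|H t s - H t0 s|]. *)
Lemma param_integral_continuous (T : topologicalType) (w : R -> R)
    (H : T -> R -> R) (c d : R) :
  mu.-integrable `[c, d] (EFin \o w) ->
  continuous (fun z : T * R => H z.1 z.2) ->
  continuous (fun t => \int[mu]_(s in `[c, d]) (w s * H t s)).
Proof.
move=> wi cH t0; apply/cvgrPdist_le => e e0.
have cHt t : continuous (H t).
  move=> s; apply: (@continuous_comp _ _ _ (fun s => (t, s)) (fun z => H z.1 z.2)).
    exact: continuous_pair_r.
  exact: cH.
have wi' := integrable_norm wi.
pose C := \int[mu]_(s in `[c, d]) `|w s|.
have C0 : 0 <= C by apply: Rintegral_ge0.
(* The + 1 avoids a division by zero when w vanishes almost everywhere. *)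
have e'0 : 0 < e / (C + 1) by rewrite divr_gt0// ltr_wpDl.
have := near_uniform_itv _ _ c d t0 _ e'0 cH; apply: filterS => t ht.
have wHi s := integrableM_continuous c d w (H s) wi (cHt s).
rewrite distrC -RintegralB//.
have cB : continuous (fun s => H t s - H t0 s).
  by move=> s; apply: cvgB; exact: cHt.
under eq_Rintegral do rewrite -mulrBr.
rewrite (le_trans (le_normr_Rintegral _ _))//; first exact: integrableM_continuous.
rewrite (@le_trans _ _ (\int[mu]_(s in `[c, d]) (`|w s| * (e / (C + 1)))))//.
  apply: le_Rintegral => //.
  - exact (integrable_norm (integrableM_continuous c d w _ wi cB)).
  - apply: (integrableM_continuous c d (fun s => `|w s|) (cst (e / (C + 1)))).
      exact: wi'.
    by move=> s; exact: cvg_cst.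
  - move=> s /= hs; rewrite normrM ler_wpM2l//; exact: ht.
rewrite RintegralZr// -/C mulrA ler_pdivrMr ?ltr_wpDl// mulrC.
by rewrite ler_wpM2l ?ltW// ltrDl.
Qed.

Lemma continuous_bounded_rect (a b c d : R) (G : R * R -> R) : continuous G ->
  exists2 M : R, 0 <= M &
    forall x y, x \in `[a, b] -> y \in `[c, d] -> `|G (x, y)| <= M.
Proof.
move=> cG.
have cK := compact_setX (@segment_compact R a b) (@segment_compact R c d).
have /compact_bounded[M [_ hM]] := continuous_compact (continuous_subspaceT cG) cK.
exists (`|M| + 1); first by rewrite addr_ge0.
move=> x y hx hy; apply: (hM (`|M| + 1)); last by exists (x, y).
by rewrite (le_lt_trans (ler_norm _))// ltrDl.
Qed.

(** Fubini's theorem needs absolute integrability in the plane. On the rectangle G is bounded by M,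
    and the integral of [|K (x - y)|] over all y is the same number C for every x, so the double
    integral is at most M * C * (b - a). *)
Lemma Rintegral_swap (a b c d : R) (K : R -> R) (G : R * R -> R) :
  mu.-integrable setT (EFin \o K) -> continuous G ->
  \int[mu]_(x in `[a, b]) \int[mu]_(y in `[c, d]) (K (x - y) * G (x, y)) =
  \int[mu]_(y in `[c, d]) \int[mu]_(x in `[a, b]) (K (x - y) * G (x, y)).
Proof.
move=> Ki cG; have [M M0 hM] := continuous_bounded_rect a b c d _ cG.
have mK : measurable_fun setT K by case/integrableP: Ki => /measurable_EFinP.
(* The indicators put the integrand on the whole plane, where [Fubini] is stated. *)
pose f (z : R * R) : \bar R :=
  (\1_`[a, b] z.1 * \1_`[c, d] z.2 * (K (z.1 - z.2) * G z))%:E.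
have cGx x : continuous (fun y => G (x, y)).
  move=> y; apply: (@continuous_comp _ _ _ (fun y => (x, y)) G); last exact: cG.
  exact: continuous_pair_r.
have cGy y : continuous (fun x => G (x, y)).
  move=> x; apply: (@continuous_comp _ _ _ (fun x => (x, y)) G); last exact: cG.
  exact: continuous_pair_l.
have mf : measurable_fun setT f.
  apply/measurable_EFinP; apply: measurable_funM.
    apply: measurable_funM.
      by apply: (measurableT_comp (measurable_indic _)) => //.
    by apply: (measurableT_comp (measurable_indic _)) => //.
  apply: measurable_funM; last exact: continuous_measurable_prodR.
  by apply: (measurableT_comp mK); exact: measurable_funB.
have KxE x : mu.-integrable setT (EFin \o (fun y => K (x - y))).
  exact: (integrable_reflect x _ Ki).
have KyE y : mu.-integrable setT (EFin \o (fun x => K (x - y))).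
  (* A translation is the composite of two reflections, here in 0 and then in y. *)
  have K'i : mu.-integrable setT (fun s => (K (- s))%:E).
    have := integrable_reflect 0 _ Ki; apply: eq_integrable => // s _ /=.
    by rewrite sub0r.
  have := integrable_reflect y _ K'i; apply: eq_integrable => // s _ /=.
  by rewrite opprB.
pose C := \int[mu]_s `|K s|.
have KxC x : (\int[mu]_y (`|K (x - y)|)%:E = C%:E)%E.
  rewrite (ge0_integral_reflect x (fun s => (`|K s|)%:E))//; last first.
    by apply/measurable_EFinP; exact: measurableT_comp.
  rewrite /C /Rintegral fineK//; apply: integrable_fin_num => //.
  exact: (integrable_norm Ki).
have C0 : 0 <= C by exact: Rintegral_ge0.
have mF : measurable_fun setT (fun x => \int[mu]_y `|f (x, y)|)%E.
  apply: (@measurable_fun_fubini_tonelli_F _ _ _ _ _ mu (abse \o f)).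
  - by apply: measurableT_comp => //; exact: mf.
  - by move=> z; exact: abse_ge0.
have fi : (mu \x mu)%E.-integrable setT f.
  apply: (integrable12ltyP mu mu mf).2.
  pose B : R -> \bar R := (EFin \o cst (M * C)) \_ `[a, b].
  apply: (@le_lt_trans _ (\bar R) (\int[mu]_x B x)%E); rewrite /B.
    apply: ge0_le_integral; first by [].
    - by move=> x _; exact: integral_ge0.
    - exact: mF.
    - apply/(measurable_restrictT _ _).1 => //; apply/measurable_EFinP.
      exact: measurable_cst.
    move=> x _; rewrite patchE; case: ifPn => hx; last first.
      rewrite integral0_eq// => y _; rewrite /f /= indicE (negbTE hx).
      by rewrite !mul0r normr0.
    rewrite /= EFinM -(KxC x) -integralZl//; last first.
      exact: (integrable_norm (KxE x)).
    apply: ge0_le_integral; [by []|by []|..].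
    - have mfx : measurable_fun setT (fun y : R => `|f (x, y)|)%E.
        by apply: measurableT_comp => //; exact: measurable_fun_pair2.
      exact mfx.
    - have mK' : measurable_fun setT (fun y : R => M%:E * (`|K (x - y)|)%:E)%E.
        apply/measurable_EFinP; apply: measurable_funM => //.
        apply: measurableT_comp => //; apply: (measurableT_comp mK).
        exact: measurable_funB.
      exact mK'.
    move=> y _; rewrite /f /= -EFinM lee_fin indicE hx mul1r indicE.
    case: (boolP (y \in _)) => hy; last by rewrite !mul0r normr0 mulr_ge0.
    rewrite mul1r normrM mulrC ler_wpM2r//.
    by apply: hM; [move: hx|move: hy]; rewrite inE.
  rewrite -integral_mkcond.
  rewrite -[X in (X < _)%E]/(\int[mu]_(x in `[a, b]) cst (M * C)%:E x)%E.
  rewrite integral_cst//= lebesgue_measure_itv/=.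
  by case: ifP => _; rewrite ?mule0 ?ltry// -EFinB -EFinM ltry.
have patchM (D : set R) (g : R -> R) x :
    (\1_D x * g x)%:E = ((EFin \o g) \_ D) x.
  by rewrite patchE indicE; case: (x \in D); rewrite ?mul1r ?mul0r.
have f12 x : (\int[mu]_y f (x, y) = (\1_`[a, b] x *
    \int[mu]_(y in `[c, d]) (K (x - y) * G (x, y)))%:E)%E.
  have hi : mu.-integrable `[c, d] (EFin \o (fun y => K (x - y) * G (x, y))).
    apply: integrableM_continuous; last exact: cGx.
    by apply: integrableS (KxE x).
  rewrite EFinM /Rintegral fineK; last exact: integrable_fin_num.
  rewrite -integralZl// [RHS]integral_mkcond; apply: eq_integral => y _.
  rewrite /f /= -mulrA mulrCA.
  rewrite (patchM _ (fun y => \1_`[a, b] x * (K (x - y) * G (x, y)))).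
  by rewrite !patchE; case: ifP.
have f21 y : (\int[mu]_x f (x, y) = (\1_`[c, d] y *
    \int[mu]_(x in `[a, b]) (K (x - y) * G (x, y)))%:E)%E.
  have hi : mu.-integrable `[a, b] (EFin \o (fun x => K (x - y) * G (x, y))).
    apply: integrableM_continuous; last exact: cGy.
    by apply: integrableS (KyE y).
  rewrite EFinM /Rintegral fineK; last exact: integrable_fin_num.
  rewrite -integralZl// [RHS]integral_mkcond; apply: eq_integral => x _.
  rewrite /f /= -mulrA.
  rewrite (patchM _ (fun x => \1_`[c, d] y * (K (x - y) * G (x, y)))).
  by rewrite !patchE; case: ifP.
pose I1 x := \int[mu]_(y in `[c, d]) (K (x - y) * G (x, y)).
pose I2 y := \int[mu]_(x in `[a, b]) (K (x - y) * G (x, y)).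
have e1 : (\int[mu]_x \int[mu]_y f (x, y) =
    \int[mu]_(x in `[a, b]) (I1 x)%:E)%E.
  rewrite [RHS]integral_mkcond; apply: eq_integral => x _.
  by rewrite f12 (patchM _ I1).
have e2 : (\int[mu]_y \int[mu]_x f (x, y) =
    \int[mu]_(y in `[c, d]) (I2 y)%:E)%E.
  rewrite [RHS]integral_mkcond; apply: eq_integral => y _.
  by rewrite f21 (patchM _ I2).
by have := Fubini fi; rewrite e1 e2 => /(congr1 fine).
Qed.
End ParamIntegrals.

(** * The one-dimensional operator K *)

Section KernelOperator.
Context {R : realType}.
Notation mu := (@lebesgue_measure R).

Lemma Rintegral_oo_cc (c d : R) (g : R -> R) :
  mu.-integrable `]c, d[ (EFin \o g) ->
  \int[mu]_(x in `]c, d[) g x = \int[mu]_(x in `[c, d]) g x.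
Proof.
move=> /integrableP[mg _]; rewrite /Rintegral; congr fine.
by rewrite (@integral_itv_bndoo _ c d (EFin \o g) true false).
Qed.

(** Agreement is required at interior points only: a kernel truncated to an open interval vanishes
    at the endpoints, where the original kernel may take any value. *)
Lemma Rintegral_sub_itv (a b c d : R) (g h : R -> R) :
  mu.-integrable `[a, b] (EFin \o g) -> a <= c -> d <= b ->
  (forall x, x \in `]a, b[ -> x \in `]c, d[ -> g x = h x) ->
  (forall x, x \in `]a, b[ -> x \notin `]c, d[ -> g x = 0) ->
  \int[mu]_(x in `[a, b]) g x = \int[mu]_(x in `[c, d]) h x.
Proof.
move=> gi ac db gh g0.
have cdab x : x \in `]c, d[ -> x \in `]a, b[.
  by rewrite !in_itv/= => /andP[h1 h2]; apply/andP; split; lra.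
have gi' : mu.-integrable `]a, b[ (EFin \o g).
  apply: integrableS gi => // x /=; rewrite !in_itv/= => /andP[h1 h2].
  by apply/andP; split; lra.
have hi : mu.-integrable `]c, d[ (EFin \o h).
  apply: (@eq_integrable _ _ _ mu _ _ (EFin \o g)) => //.
    by move=> x; rewrite inE /= => hx; rewrite gh ?cdab.
  by apply: integrableS gi' => // x /=; exact: cdab.
rewrite -Rintegral_oo_cc// -Rintegral_oo_cc//.
rewrite Rintegral_mkcond [RHS]Rintegral_mkcond; apply: eq_Rintegral => x _.
rewrite !patchE; case: ifPn; rewrite ?inE ?notin_setE /= => hx.
  case: ifPn; rewrite ?inE ?notin_setE /= => hx'; first exact: gh.
  by apply: g0 => //; apply/negP.
by case: ifPn => //; rewrite inE /= => /cdab.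
Qed.

Variables (k : R -> R) (L : R).

(* K_P f is the convolution of f with [kappa p q] on [a, b]; exchanging p and q
   reflects the kernel, so that duality is Fubini's theorem. *)
Definition ktrunc : R -> R := k \_ `]0, L[.

Definition kappa (p q : R) (s : R) : R := p * ktrunc s + q * ktrunc (- s).

Lemma kappaN p q s : kappa p q (- s) = kappa q p s.
Proof. by rewrite /kappa opprK addrC. Qed.

Lemma kappa_supp p q s : s \notin `[(- L), L] -> kappa p q s = 0.
Proof.
rewrite in_itv/= => hs; rewrite /kappa /ktrunc !patchE.
rewrite memNset ?memNset ?mulr0 ?addr0//= in_itv/= => /andP[h1 h2];
  by move/negP: hs; apply; apply/andP; split; lra.
Qed.

Hypothesis ki : mu.-integrable `]0, L[ (EFin \o k).

Lemma ktrunc_integrable : mu.-integrable setT (EFin \o ktrunc).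
Proof.
by move: ki; rewrite integrable_mkcond//= restrict_EFin.
Qed.

Lemma ktruncN_integrable : mu.-integrable setT (EFin \o (fun s => ktrunc (- s))).
Proof.
have := integrable_reflect 0 _ ktrunc_integrable.
by apply: eq_integrable => // s _ /=; rewrite sub0r.
Qed.

Lemma integrable_scale (D : set R) (p : R) (f : R -> R) : measurable D ->
  mu.-integrable D (EFin \o f) -> mu.-integrable D (EFin \o (fun x => p * f x)).
Proof.
move=> mD fi; apply: (@eq_integrable _ _ _ mu _ mD
  (fun x => p%:E * (EFin \o f) x)%E) => //.
exact: integrableZl.
Qed.

Lemma integrable_lin (D : set R) (p q : R) (f g : R -> R) : measurable D ->
  mu.-integrable D (EFin \o f) -> mu.-integrable D (EFin \o g) ->
  mu.-integrable D (EFin \o (fun x => p * f x + q * g x)).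
Proof.
move=> mD fi gi.
apply: (@eq_integrable _ _ _ mu _ mD
  ((EFin \o (fun x => p * f x)%R) \+ (EFin \o (fun x => q * g x)%R))%E) => //.
by apply: integrableD => //; exact: integrable_scale.
Qed.

Lemma kappa_integrable p q : mu.-integrable setT (EFin \o kappa p q).
Proof.
apply: (integrable_lin setT p q) => //; first exact: ktrunc_integrable.
exact: ktruncN_integrable.
Qed.

Variables (a b : R).
Hypothesis Lab : b - a <= L.

(** [Kop] read along one line parallel to an axis, as a function of the moving coordinate. *)
Definition K1 (p q : R) (f : R -> R) (x : R) : R :=
  p * (\int[mu]_(y in `[a, x]) (k (x - y) * f y)) +
  q * (\int[mu]_(y in `[x, b]) (k (y - x) * f y)).

Lemma kappa_reflectM_integrable (c d : R) p q x (f : R -> R) : continuous f ->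
  mu.-integrable `[c, d] (EFin \o (fun y => kappa p q (x - y) * f y)).
Proof.
move=> cf; apply: integrableM_continuous => //.
apply: (integrableS measurableT) => //.
exact: (integrable_reflect x _ (kappa_integrable p q)).
Qed.

(** The moving limits are absorbed by the truncation: for y in the open interval, x - y lies in ]0,
    L[ exactly when y < x, and y - x exactly when y > x, since both differences are below b - a <=
    L. *)
Lemma K1E p q (f : R -> R) x : continuous f -> x \in `[a, b] ->
  K1 p q f x = \int[mu]_(y in `[a, b]) (kappa p q (x - y) * f y).
Proof.
move=> cf; rewrite in_itv/= => /andP[ax xb].
have i1 : mu.-integrable `[a, b] (EFin \o (fun y => ktrunc (x - y) * f y)).
  apply: integrableM_continuous => //; apply: (integrableS measurableT) => //.
  exact: (integrable_reflect x _ ktrunc_integrable).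
have i2 : mu.-integrable `[a, b] (EFin \o (fun y => ktrunc (y - x) * f y)).
  apply: integrableM_continuous => //; apply: (integrableS measurableT) => //.
  have := integrable_reflect x _ ktruncN_integrable.
  by apply: eq_integrable => // s _ /=; rewrite opprB.
have -> : \int[mu]_(y in `[a, b]) (kappa p q (x - y) * f y) =
    \int[mu]_(y in `[a, b]) (p * (ktrunc (x - y) * f y) +
                             q * (ktrunc (y - x) * f y)).
  by apply: eq_Rintegral => y _; rewrite /kappa opprB mulrDl !mulrA.
rewrite RintegralD//; last 2 first.
  exact: integrable_scale.
  exact: integrable_scale.
rewrite !RintegralZl// /K1; congr (_ * _ + _ * _); apply/esym.
  apply: Rintegral_sub_itv => // y; rewrite !in_itv/= => /andP[h1 h2].
    move=> /andP[h3 h4]; rewrite /ktrunc patchE mem_set//= in_itv/=.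
    by have := Lab => ?; apply/andP; split; lra.
  move=> h3; rewrite /ktrunc patchE memNset ?mul0r//= in_itv/= => /andP[h4 h5].
  by move/negP: h3; apply; apply/andP; split; lra.
apply: Rintegral_sub_itv => // y; rewrite !in_itv/= => /andP[h1 h2].
  move=> /andP[h3 h4]; rewrite /ktrunc patchE mem_set//= in_itv/=.
  by have := Lab => ?; apply/andP; split; lra.
move=> h3; rewrite /ktrunc patchE memNset ?mul0r//= in_itv/= => /andP[h4 h5].
by move/negP: h3; apply; apply/andP; split; lra.
Qed.

(** As f vanishes off [a, b], the integral extends to the whole line and y = x - s can be
    substituted. Then x occurs in the continuous factor only, and the weight [kappa p q] is
    fixed. *)
Lemma K1_conv p q (f : R -> R) x : continuous f ->
  (forall y, y \notin `[a, b] -> f y = 0) ->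
  x \in `[a, b] ->
  K1 p q f x = \int[mu]_(s in `[(- L), L]) (kappa p q s * f (x - s)).
Proof.
move=> cf f0 xab; rewrite K1E//.
pose g s := kappa p q s * f (x - s).
have gE y : g (x - y) = kappa p q (x - y) * f y by rewrite /g subKr.
have gi : mu.-integrable setT (EFin \o (fun y => g (x - y))).
  have := kappa_reflectM_integrable a b p q x f cf.
  rewrite integrable_mkcond//=.
  apply: eq_integrable => // y _; rewrite patchE; case: ifPn => //=.
    by rewrite gE.
  rewrite notin_setE /= => /negP hy; by rewrite gE f0// mulr0.
have gi' : mu.-integrable setT (EFin \o g).
  have := integrable_reflect x _ gi.
  by apply: eq_integrable => // s _ /=; rewrite subKr.
transitivity (\int[mu]_y g (x - y)).
  rewrite Rintegral_mkcond; apply: eq_Rintegral => y _; rewrite patchE gE.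
  case: ifPn => //; rewrite notin_setE /= => /negP hy; by rewrite f0// mulr0.
rewrite [RHS]Rintegral_mkcond; transitivity (\int[mu]_y g y).
  by rewrite /Rintegral (integral_reflect x _ gi').
apply: eq_Rintegral => s _; rewrite patchE /g.
case: ifPn => //; rewrite notin_setE /= => /negP hs; by rewrite kappa_supp// mul0r.
Qed.

Lemma K1_dual p q (f g : R -> R) : continuous f -> continuous g ->
  \int[mu]_(x in `[a, b]) (g x * K1 p q f x) =
  \int[mu]_(y in `[a, b]) (f y * K1 q p g y).
Proof.
move=> cf cg; pose G (z : R * R) := f z.2 * g z.1.
have cG : continuous G.
  move=> z; apply: cvgM.
    by apply: (continuous_comp (f := snd)); [exact: cvg_snd|exact: cf].
  by apply: (continuous_comp (f := fst)); [exact: cvg_fst|exact: cg].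
transitivity (\int[mu]_(x in `[a, b]) \int[mu]_(y in `[a, b])
    (kappa p q (x - y) * G (x, y))).
  apply: eq_Rintegral => x; rewrite inE /= => hx; rewrite K1E//.
  rewrite -RintegralZl//; last exact: kappa_reflectM_integrable.
  by apply: eq_Rintegral => y _; rewrite /G /= mulrC -mulrA.
rewrite Rintegral_swap//; last exact: kappa_integrable.
apply: eq_Rintegral => y; rewrite inE /= => hy; rewrite K1E//.
rewrite -RintegralZl//; last exact: kappa_reflectM_integrable.
apply: eq_Rintegral => x _; rewrite /G /= -[x - y]opprB kappaN.
by rewrite mulrCA.
Qed.

Lemma K1_lin p q (e : R) (f g : R -> R) x :
  continuous f -> continuous g -> x \in `[a, b] ->
  K1 p q (fun y => f y + e * g y) x = K1 p q f x + e * K1 p q g x.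
Proof.
move=> cf cg xab.
have cfg : continuous (fun y => f y + e * g y).
  by move=> y; apply: cvgD; [exact: cf|apply: cvgM; [exact: cvg_cst|exact: cg]].
rewrite !K1E// -RintegralZl//; last exact: kappa_reflectM_integrable.
rewrite -RintegralD//; last 2 first.
  exact: kappa_reflectM_integrable.
  by apply: integrable_scale => //; exact: kappa_reflectM_integrable.
by apply: eq_Rintegral => y _; rewrite mulrDr mulrCA.
Qed.

End KernelOperator.

(** * Row vectors and boxes *)

Section MatrixTopology.
Context {R : realType}.

Lemma mx_continuous (T : topologicalType) (m n : nat) (f : T -> 'M[R]_(m, n)) :
  (forall i j, continuous (fun x => f x i j)) -> continuous f.
Proof.
move=> cf x; apply/cvg_ballP => e e0.
have h i : \forall y \near x, forall j, `|f x i j - f y i j| < e.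
  by apply: filter_forall => j; have /cvgrPdist_lt := cf i j x; exact.
near=> y.
have hy : forall i j, `|f x i j - f y i j| < e.
  near: y; exact: (@filter_forall _ _
    (fun i y => forall j, `|f x i j - f y i j| < e) (nbhs x) _ h).
by split=> // i j; rewrite -ball_normE; exact: hy.
Unshelve. all: by end_near. Qed.

Lemma sum_continuous (T : topologicalType) (I : Type) (r : seq I)
    (G : I -> T -> R) : (forall i, continuous (G i)) ->
  continuous (fun t => \sum_(i <- r) G i t).
Proof.
move=> cG; elim: r => [|i r IH].
  by under eq_fun do rewrite big_nil; move=> x; exact: cvg_cst.
under eq_fun do rewrite big_cons.
by move=> x; apply: cvgD; [exact: cG|exact: IH].
Qed.

Lemma max_cst_continuous (c : R) : continuous (fun x : R => Num.max x c).
Proof.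
move=> x; apply/cvgrPdist_lt => e e0; near=> y.
have xy : `|x - y| < e by near: y; exact: (nbhsx_ballx x e e0).
apply: le_lt_trans xy; rewrite ler_norml.
have h1 : x - y <= `|x - y| by exact: ler_norm.
have h2 : - `|x - y| <= x - y by exact: lerNnormlW.
by case: (leP x c) => ?; case: (leP y c) => ?; apply/andP; split; lra.
Unshelve. all: by end_near. Qed.

Lemma min_cst_continuous (c : R) : continuous (fun x : R => Num.min x c).
Proof.
have -> : (fun x : R => Num.min x c) = (fun x => - Num.max (- x) (- c)).
  by apply/funext => x; rewrite oppr_max !opprK.
move=> x.
have h : continuous (fun x : R => - x) by exact: opp_continuous.
exact: (cvgN (continuous_comp (h x) (max_cst_continuous (- c) (- x)))).
Qed.

Context {n : nat}.
Implicit Types (t : 'rV[R]_n) (a b : 'rV[R]_n).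

Lemma updE t i s j : upd t i s 0 j = if j == i then s else t 0 j.
Proof. by rewrite mxE. Qed.

Lemma upd_continuous (T : topologicalType) (f : T -> 'rV[R]_n) i (g : T -> R) :
  continuous f -> continuous g -> continuous (fun x => upd (f x) i (g x)).
Proof.
move=> cf cg; apply: mx_continuous => z j.
have -> : (fun x => upd (f x) i (g x) z j) =
    (fun x => if j == i then g x else f x 0 j).
  by apply/funext => x; rewrite mxE.
case: eqP => _ x; first exact: cg.
have cj : {for f x, continuous (fun t : 'rV[R]_n => t 0 j)}.
  exact: coord_continuous.
exact: (continuous_comp (cf x) cj).
Qed.

Lemma upd_id t i : upd t i (t 0 i) = t.
Proof. by apply/rowP => j; rewrite updE; case: eqP => // ->. Qed.

Lemma upd_upd t i s s' : upd (upd t i s) i s' = upd t i s'.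
Proof. by apply/rowP => j; rewrite !updE; case: eqP. Qed.

Lemma updC t i j s s' : i != j -> upd (upd t i s) j s' = upd (upd t j s') i s.
Proof.
move=> ij; apply/rowP => l; rewrite !updE; case: (eqVneq l j) => // ->.
by rewrite eq_sym (negbTE ij).
Qed.

(** Links the two ways of moving along an axis: [upd] in the integrals and in [Kop], increments by a
    multiple of a basis vector in [dquot]. *)
Lemma updDe t i h : upd t i (t 0 i + h) = t + h *: ebasis i.
Proof.
apply/rowP => j; rewrite updE !mxE /=; case: eqP => [->|_].
  by rewrite mulr1.
by rewrite mulr0 addr0.
Qed.

Lemma upd_cbox a b t i s : cbox a b t -> s \in `[a 0 i, b 0 i] ->
  cbox a b (upd t i s).
Proof.
move=> ht hs j; rewrite updE; case: eqP => [->|_]; last exact: ht.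
by move: hs; rewrite in_itv.
Qed.

(* Composing with the retraction [clamp] turns continuity within the box into
   continuity everywhere, and is invisible to [iint] and [Kop]. *)
Definition clamp a b t : 'rV[R]_n :=
  \row_j Num.min (Num.max (t 0 j) (a 0 j)) (b 0 j).

Lemma clamp_continuous a b : continuous (clamp a b).
Proof.
apply: mx_continuous => z j x.
have -> : (fun t => clamp a b t z j) =
    (fun t => Num.min (Num.max (t 0 j) (a 0 j)) (b 0 j)).
  by apply/funext => t; rewrite mxE.
apply: (@continuous_comp _ _ _ (fun t : 'rV[R]_n => Num.max (t 0 j) (a 0 j))
  (fun y => Num.min y (b 0 j))); last exact: min_cst_continuous.
apply: (@continuous_comp _ _ _ (fun t : 'rV[R]_n => t 0 j)
  (fun y => Num.max y (a 0 j))); last exact: max_cst_continuous.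
exact: coord_continuous.
Qed.

Lemma clamp_cbox a b t : (forall i, a 0 i < b 0 i) -> cbox a b (clamp a b t).
Proof.
move=> ab i; rewrite mxE le_min ge_min le_max lexx orbT (ltW (ab i))/=.
by rewrite lexx orbT.
Qed.

Lemma clamp_id a b t : cbox a b t -> clamp a b t = t.
Proof.
move=> ht; apply/rowP => j; rewrite mxE; have /andP[h1 h2] := ht j.
by rewrite max_l// min_l.
Qed.

Lemma continuous_clamp (W : topologicalType) a b (G : 'rV[R]_n -> W) :
  (forall i, a 0 i < b 0 i) ->
  {within cbox a b, continuous G} -> continuous (G \o clamp a b).
Proof.
move=> ab /subspace_continuousP cG x.
apply: cvg_comp (cG _ (clamp_cbox _ _ _ ab)).
move=> A hA; have h := clamp_continuous a b x _ hA.
apply: (@filterS _ (nbhs x) _ _ _ _ h) => y /=.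
by apply; exact: clamp_cbox.
Qed.

Lemma cbox_compact a b : compact (cbox a b).
Proof.
have := @rV_compact R n (fun i => `[a 0 i, b 0 i]%classic)
  (fun i => @segment_compact _ _ _).
by congr compact; apply/seteqP; split => t /= ht i; have := ht i; rewrite /= in_itv.
Qed.

End MatrixTopology.

(** * Iterated integrals *)

Section IteratedIntegrals.
Context {R : realType} {n : nat}.
Notation mu := (@lebesgue_measure R).
Variables (a b : 'rV[R]_n).
Implicit Types (t : 'rV[R]_n) (G H : 'rV[R]_n -> R) (s : seq 'I_n).

Definition Int (i : 'I_n) G t : R :=
  \int[mu]_(x in `[a 0 i, b 0 i]) G (upd t i x).

(** Any list of coordinates and any base point are allowed, as the inductions on the list
    require. *)
Definition iints s G : 'rV[R]_n -> R := foldr Int G s.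

Lemma iintE G : iint a b G = iints (enum 'I_n) G 0.
Proof. by []. Qed.

(** The base point 0 of [iint] may lie outside the box. The two conditions on t' record which
    coordinates are still inherited from it; once all have been integrated, only points of the box
    remain. *)
Lemma iints_ext s G H t :
  (forall t', (forall j, j \notin s -> t' 0 j = t 0 j) ->
     (forall j, j \in s -> a 0 j <= t' 0 j <= b 0 j) -> G t' = H t') ->
  iints s G t = iints s H t.
Proof.
elim: s t => [|i s IH] t GH; first by apply: GH.
apply: eq_Rintegral => x; rewrite inE /= in_itv/= => hx.
apply: IH => t' h1 h2; apply: GH => j.
  rewrite in_cons negb_or => /andP[ji js]; rewrite h1// updE.
  by rewrite (negbTE ji).
rewrite in_cons; case: (boolP (j \in s)) => [js _|js]; first exact: h2.
by rewrite orbF => /eqP ji; rewrite h1// updE ji eqxx.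
Qed.

Lemma iint_ext G H : (forall t, cbox a b t -> G t = H t) ->
  iint a b G = iint a b H.
Proof.
move=> GH; rewrite !iintE; apply: iints_ext => t _ h; apply: GH => i.
by apply: h; rewrite mem_enum.
Qed.

(** Used with the full list, to move the base point from 0 to a point where the integrand is
    positive. *)
Lemma iints_dep s G t t' : (forall j, j \notin s -> t 0 j = t' 0 j) ->
  iints s G t = iints s G t'.
Proof.
elim: s t t' => [|i s IH] t t' tt'; first by congr G; apply/rowP => j; exact: tt'.
apply: eq_Rintegral => x _; apply: IH => j js; rewrite !updE.
by case: eqP => // /eqP ji; apply: tt'; rewrite in_cons negb_or ji.
Qed.

Lemma upd_comp_continuous i G : continuous G ->
  continuous (fun z : 'rV[R]_n * R => G (upd z.1 i z.2)).
Proof.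
move=> cG z.
have cu : continuous (fun z : 'rV[R]_n * R => upd z.1 i z.2).
  by apply: upd_continuous => ?; [exact: cvg_fst|exact: cvg_snd].
exact: (continuous_comp (cu z) (cG _)).
Qed.

Lemma upd_line_continuous i t G : continuous G ->
  continuous (fun x : R => G (upd t i x)).
Proof.
move=> cG x; have cu : continuous (fun x : R => upd t i x).
  by apply: upd_continuous => ?; [exact: cvg_cst|exact: cvg_id].
exact: (continuous_comp (cu x) (cG _)).
Qed.

Lemma cst1_integrable (c d : R) : mu.-integrable `[c, d] (EFin \o cst (1 : R)).
Proof. by apply: continuous_integrable => x; exact: cvg_cst. Qed.

Lemma Int_continuous i G : continuous G -> continuous (Int i G).
Proof.
move=> cG; have -> : Int i G =
    (fun t => \int[mu]_(x in `[a 0 i, b 0 i]) (cst 1 x * G (upd t i x))).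
  by apply/funext => t; apply: eq_Rintegral => x _; rewrite mul1r.
apply: (param_integral_continuous _ _ (fun t x => G (upd t i x))).
  exact: cst1_integrable.
exact: upd_comp_continuous.
Qed.

Lemma iints_continuous s G : continuous G -> continuous (iints s G).
Proof. by move=> cG; elim: s => // i s IH; exact: Int_continuous. Qed.

Lemma Int_swap i j G : continuous G -> Int i (Int j G) = Int j (Int i G).
Proof.
move=> cG; have [->//|ij] := eqVneq i j; apply/funext => t.
(* [Rintegral_swap] with a kernel [K] equal to 1 on all the differences x - y. *)
pose M := `|a 0 i| + `|b 0 i| + `|a 0 j| + `|b 0 j|.
pose K : R -> R := (cst 1 : R -> R) \_ `[(- M), M].
have Ki : mu.-integrable setT (EFin \o K).
  have := cst1_integrable (- M) M.
  by rewrite integrable_mkcond//= restrict_EFin.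
have K1 x y : x \in `[a 0 i, b 0 i] -> y \in `[a 0 j, b 0 j] -> K (x - y) = 1.
  rewrite !in_itv/= => /andP[h1 h2] /andP[h3 h4].
  rewrite /K patchE mem_set//= in_itv/= /M.
  have nb (r : R) : - `|r| <= r /\ r <= `|r|.
    by split; [exact: lerNnormlW|exact: ler_norm].
  have [? ?] := nb (a 0 i); have [? ?] := nb (b 0 i).
  have [? ?] := nb (a 0 j); have [? ?] := nb (b 0 j).
  by apply/andP; split; lra.
pose G2 (z : R * R) := G (upd (upd t i z.1) j z.2).
have cG2 : continuous G2.
  move=> z; have cu : continuous (fun z : R * R => upd (upd t i z.1) j z.2).
    apply: upd_continuous; last by move=> ?; exact: cvg_snd.
    by apply: upd_continuous => ?; [exact: cvg_cst|exact: cvg_fst].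
  exact: (continuous_comp (cu z) (cG _)).
transitivity (\int[mu]_(x in `[a 0 i, b 0 i]) \int[mu]_(y in `[a 0 j, b 0 j])
    (K (x - y) * G2 (x, y))).
  apply: eq_Rintegral => x; rewrite inE /= => hx.
  apply: eq_Rintegral => y; rewrite inE /= => hy.
  by rewrite (K1 x y hx hy) mul1r.
rewrite (Rintegral_swap _ _ _ _ K G2 Ki cG2).
apply: eq_Rintegral => y; rewrite inE /= => hy.
apply: eq_Rintegral => x; rewrite inE /= => hx.
by rewrite (K1 x y hx hy) mul1r /G2/= updC.
Qed.

Lemma iints_Int s i G : continuous G -> Int i (iints s G) = iints s (Int i G).
Proof.
move=> cG; elim: s => //= j s IH; rewrite -IH Int_swap//.
exact: iints_continuous.
Qed.

(** An equality of functions of the base point, so that the induction hypothesis rewrites under the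
    outer integral. *)
Lemma iints_lin s (c : R) G H : continuous G -> continuous H ->
  iints s (fun t => G t + c * H t) = (fun t => iints s G t + c * iints s H t).
Proof.
move=> cG cH; elim: s => //= i s ->; apply/funext => t; rewrite /Int.
have i1 := continuous_integrable (a 0 i) (b 0 i) _
  (upd_line_continuous i t _ (iints_continuous s _ cG)).
have i2 := continuous_integrable (a 0 i) (b 0 i) _
  (upd_line_continuous i t _ (iints_continuous s _ cH)).
rewrite -RintegralZl// -RintegralD//; exact: integrable_scale.
Qed.

Lemma iints_bound s (d : R) G t : (forall i, a 0 i <= b 0 i) -> continuous G ->
  (forall t, `|G t| <= d) ->
  `|iints s G t| <= d * \prod_(i <- s) (b 0 i - a 0 i).
Proof.
move=> ab cG Gd; elim: s t => [|i s IH] t; first by rewrite big_nil mulr1.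
set D := d * \prod_(j <- s) (b 0 j - a 0 j).
have ci := upd_line_continuous i t _ (iints_continuous s _ cG).
have i1 := continuous_integrable (a 0 i) (b 0 i) _ ci.
rewrite -[iints _ _ _]/(Int i (iints s G) t) /Int.
rewrite (le_trans (le_normr_Rintegral _ i1))//.
apply: (@le_trans _ _ (\int[mu]_(x in `[a 0 i, b 0 i]) D)).
  apply: le_Rintegral => //.
  - exact (integrable_norm i1).
  - by apply: continuous_integrable => x; exact: cvg_cst.
rewrite Rintegral_cst//= lebesgue_measure_itv/= lte_fin big_cons.
case: ltP => [_|ba]/=; first by rewrite /D mulrC mulrCA.
have -> : b 0 i - a 0 i = 0 by apply/eqP; rewrite subr_eq0 eq_le ba ab.
by rewrite mul0r !mulr0.
Qed.

Lemma Rintegral_gt0 (c d x0 : R) (f : R -> R) : continuous f ->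
  (forall x, 0 <= f x) -> c < x0 < d -> 0 < f x0 ->
  0 < \int[mu]_(x in `[c, d]) f x.
Proof.
move=> cf f0 /andP[cx xd] fx0.
have e0 : 0 < f x0 / 2 by rewrite divr_gt0.
have /cvgrPdist_lt/(_ _ e0) := cf x0.
move=> /nbhs_ballP[r /= r0 hr].
(* A segment around x0, of positive length, inside both [c, d] and the ball on which f stays above
   half of f x0. *)
pose u := Num.max c (x0 - r / 2); pose v := Num.min d (x0 + r / 2).
have cu : c <= u by rewrite le_max lexx.
have vd : v <= d by rewrite ge_min lexx.
have r20 : 0 < r / 2 by rewrite divr_gt0.
have r2 : r / 2 < r by lra.
have ux : u < x0 by rewrite gt_max cx/=; lra.
have xv : x0 < v by rewrite lt_min xd/=; lra.
have uvE x : x \in `[u, v] -> f x0 / 2 <= f x.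
  rewrite in_itv/= ge_max le_min => /andP[/andP[h1 h2] /andP[h3 h4]].
  have : ball x0 r x.
    by rewrite -ball_normE /ball_ /= ltr_norml; apply/andP; split; lra.
  by move=> /hr /=; rewrite ltr_norml => /andP[h5 h6]; lra.
have fi := continuous_integrable c d _ cf.
have fi' := continuous_integrable u v _ cf.
apply: (@lt_le_trans _ _ (\int[mu]_(x in `[u, v]) (f x0 / 2))).
  rewrite Rintegral_cst//= lebesgue_measure_itv/= lte_fin (lt_trans ux xv)/=.
  by rewrite mulr_gt0// subr_gt0 (lt_trans ux).
apply: (@le_trans _ _ (\int[mu]_(x in `[u, v]) f x)).
  apply: le_Rintegral => [//||//|x /uvE//].
  by apply: continuous_integrable => x; exact: cvg_cst.
have fi1 : mu.-integrable setT (EFin \o (f \_ `[u, v])).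
  by move: fi'; rewrite integrable_mkcond//= restrict_EFin.
have fi2 : mu.-integrable setT (EFin \o (f \_ `[c, d])).
  by move: fi; rewrite integrable_mkcond//= restrict_EFin.
rewrite Rintegral_mkcond [leRHS]Rintegral_mkcond.
apply: (le_Rintegral measurableT fi1 fi2) => x _.
rewrite !patchE; case: ifPn; case: ifPn => //.
rewrite notin_setE inE /= !in_itv/= => h /andP[h1 h2].
by exfalso; apply: h; apply/andP; split; lra.
Qed.

(** Strict positivity is tracked at t0 alone: each integrand along the i-th axis is continuous and
    nonnegative, and at x = t0 0 i it is the value already known to be positive, because
    [upd t0 i (t0 0 i)] is t0. *)
Lemma iints_gt0 s G t0 : continuous G -> (forall t, 0 <= G t) ->
  obox a b t0 -> 0 < G t0 -> 0 < iints s G t0.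
Proof.
move=> cG G0 t0ab Gt0.
suff [] : 0 < iints s G t0 /\ forall t, 0 <= iints s G t by [].
elim: s => [//|i s [IH1 IH2]]; split; last first.
  by move=> t; apply: Rintegral_ge0 => x _; exact: IH2.
apply: (Rintegral_gt0 _ _ (t0 0 i)); last by rewrite upd_id.
- by apply: upd_line_continuous; exact: iints_continuous.
- by move=> x; exact: IH2.
- exact: t0ab.
Qed.

Lemma iint_gt0 G t0 : continuous G -> (forall t, 0 <= G t) ->
  obox a b t0 -> 0 < G t0 -> 0 < iint a b G.
Proof.
move=> cG G0 t0ab Gt0; rewrite iintE (@iints_dep _ _ _ t0).
  exact: iints_gt0.
by move=> j; rewrite mem_enum.
Qed.

Hypothesis ab : forall i, a 0 i < b 0 i.

Lemma iint_clamp G : iint a b G = iint a b (G \o clamp a b).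
Proof. by apply: iint_ext => t ht; rewrite /= clamp_id. Qed.

Lemma iint_lin (c : R) G H :
  {within cbox a b, continuous G} -> {within cbox a b, continuous H} ->
  iint a b (fun t => G t + c * H t) = iint a b G + c * iint a b H.
Proof.
move=> /(continuous_clamp _ _ _ _ ab) cG /(continuous_clamp _ _ _ _ ab) cH.
rewrite [LHS]iint_clamp (iint_clamp G) (iint_clamp H) !iintE.
by rewrite -[RHS](congr1 (@^~ 0) (iints_lin (enum 'I_n) c _ _ cG cH)).
Qed.

Lemma iint_bound (d : R) G : {within cbox a b, continuous G} ->
  (forall t, cbox a b t -> `|G t| <= d) ->
  `|iint a b G| <= d * \prod_i (b 0 i - a 0 i).
Proof.
move=> cG Gd; rewrite iint_clamp iintE -big_enum.
apply: iints_bound; first by move=> i; exact: ltW.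
  exact: continuous_clamp.
by move=> t; apply: Gd; exact: clamp_cbox.
Qed.

Lemma iint_cst0 : iint a b (fun=> 0) = 0.
Proof.
apply/eqP; rewrite -normr_le0.
have c0 : {within cbox a b, continuous (fun=> 0 : R)}.
  by move=> x; exact: cvg_cst.
by rewrite (le_trans (iint_bound 0 _ c0 _)) ?mul0r// => t _; rewrite normr0.
Qed.

Lemma iintZ (c : R) G : {within cbox a b, continuous G} ->
  iint a b (fun t => c * G t) = c * iint a b G.
Proof.
move=> cG; have c0 : {within cbox a b, continuous (fun=> 0 : R)}.
  by move=> x; exact: cvg_cst.
rewrite -[RHS]add0r -iint_cst0 -iint_lin//.
by apply: iint_ext => t _; rewrite add0r.
Qed.

Lemma iintD G H :
  {within cbox a b, continuous G} -> {within cbox a b, continuous H} ->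
  iint a b (fun t => G t + H t) = iint a b G + iint a b H.
Proof.
move=> cG cH; rewrite -[X in _ + X]mul1r -iint_lin//.
by apply: iint_ext => t _; rewrite mul1r.
Qed.

Lemma iint_sum (I : Type) (r : seq I) (G : I -> 'rV[R]_n -> R) :
  (forall i, {within cbox a b, continuous (G i)}) ->
  iint a b (fun t => \sum_(i <- r) G i t) = \sum_(i <- r) iint a b (G i).
Proof.
move=> cG; elim: r => [|i r IH].
  rewrite big_nil -[RHS]iint_cst0; apply: iint_ext => t _; exact: big_nil.
rewrite big_cons -IH -iintD//; last first.
  exact: (@sum_continuous _ (subspace (cbox a b))).
by apply: iint_ext => t _; rewrite big_cons.
Qed.

Lemma iint_addsum (A : 'rV[R]_n -> R) (B C : 'I_n -> 'rV[R]_n -> R) :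
  {within cbox a b, continuous A} ->
  (forall i, {within cbox a b, continuous (B i)}) ->
  (forall i, {within cbox a b, continuous (C i)}) ->
  iint a b (fun t => A t + (\sum_i B i t + \sum_i C i t)) =
  iint a b A + (\sum_i iint a b (B i) + \sum_i iint a b (C i)).
Proof.
move=> cA cB cC.
have sc (D : 'I_n -> 'rV[R]_n -> R) :
    (forall i, {within cbox a b, continuous (D i)}) ->
    {within cbox a b, continuous (fun t => \sum_i D i t)}.
  exact: (@sum_continuous _ (subspace (cbox a b))).
have sB := sc _ cB; have sC := sc _ cC.
rewrite (iintD A (fun t => \sum_i B i t + \sum_i C i t))//; last first.
  by move=> t; exact: (cvgD (sB t) (sC t)).
by rewrite (iintD _ _ sB sC) (iint_sum _ _ _ cB) (iint_sum _ _ _ cC).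
Qed.

Lemma Int_clamp i G t : Int i (G \o clamp a b) t = Int i G (clamp a b t).
Proof.
apply: eq_Rintegral => x; rewrite inE /= in_itv/= => /andP[h1 h2].
congr G; apply/rowP => j; rewrite !mxE; case: eqP => // ->.
by rewrite max_l// min_l.
Qed.

(** Lifts one-variable identities to the box. The list of coordinates is split at i and the i-th
    integral is moved past the tail so that it acts first; the clamp makes the hypothesis on points
    of the box sufficient at every base point. *)
Lemma eq_iint_Int i G H :
  {within cbox a b, continuous G} -> {within cbox a b, continuous H} ->
  (forall t, cbox a b t -> Int i G t = Int i H t) ->
  iint a b G = iint a b H.
Proof.
move=> /(continuous_clamp _ _ _ _ ab) cG /(continuous_clamp _ _ _ _ ab) cH GH.
rewrite (iint_clamp G) (iint_clamp H) !iintE.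
have : i \in enum 'I_n by rewrite mem_enum.
case/splitPr => s1 s2; rewrite /iints !foldr_cat /= -/(iints s2) !iints_Int//.
congr (foldr _ (iints _ _) _ _); apply/funext => t.
by rewrite !Int_clamp GH//; exact: clamp_cbox.
Qed.

End IteratedIntegrals.

(** * Directional derivatives within a box *)

Section DirectionalDerivatives.
Context {R : realType} {V W : normedModType R}.
Implicit Types (D : set V) (f g : V -> W) (z e : V).

(** Limits along [dfilter] are unique only if the filter is proper, that is, if D contains z + h e
    for arbitrarily small nonzero h. *)
Lemma dfilter_proper D z e :
  (forall r : R, 0 < r -> exists h, 0 < `|h| < r /\ D (z + h *: e)) ->
  ProperFilter (dfilter D z e).
Proof.
move=> hD; rewrite /dfilter; split; last exact: within_filter.
move=> /nbhs_ballP[r /= r0 hr].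
have [h [/andP[h0 hr'] Dh]] := hD _ r0; apply: (hr h).
  by rewrite -ball_normE /ball_ /= sub0r normrN.
by split => //; rewrite -normr_gt0.
Qed.

Lemma dnbhs_dfilter D z e f (l : W) :
  dquot f z e @ (0 : R)^' --> l -> dquot f z e @ dfilter D z e --> l.
Proof.
move=> h; apply: cvg_trans h; apply: cvg_app; rewrite /dfilter.
move=> P; rewrite /dnbhs /within /= => hP.
by apply: (@filterS _ (nbhs (0 : R)) _ _ _ _ hP) => x Px [x0 _]; exact: Px.
Qed.

Lemma dfilter_dnbhs D z e f (l : W) :
  (\forall h \near (0 : R), D (z + h *: e)) ->
  dquot f z e @ dfilter D z e --> l -> dquot f z e @ (0 : R)^' --> l.
Proof.
move=> hD h; apply: cvg_trans h; apply: cvg_app; rewrite /dfilter.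
move=> P hP.
have hP' : \forall x \near (0 : R), x != 0 /\ D (z + x *: e) -> P x by exact: hP.
suff : \forall x \near (0 : R), x != 0 -> P x by [].
by apply: filterS2 hD hP' => x Dx Px x0; exact: Px.
Qed.

Lemma dquot_lin D z e f g (c : R) (l m : W) :
  dquot f z e @ dfilter D z e --> l -> dquot g z e @ dfilter D z e --> m ->
  dquot (fun x => f x + c *: g x) z e @ dfilter D z e --> l + c *: m.
Proof.
move=> hf hg.
have -> : dquot (fun x => f x + c *: g x) z e =
    (fun h => dquot f z e h + c *: dquot g z e h).
  apply/funext => h; rewrite /dquot [c *: (_ *: _)]scalerA mulrC -scalerA.
  by rewrite -scalerDr; congr (_ *: _); rewrite scalerBr opprD addrACA.
by apply: cvgD => //; apply: cvgZl_tmp.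
Qed.

Lemma dderiv_withinE D z e f (l : W) : ProperFilter (dfilter D z e) ->
  dquot f z e @ dfilter D z e --> l -> dderiv_within D f z e = l.
Proof. by move=> FF; apply: cvg_lim; exact: norm_hausdorff. Qed.

End DirectionalDerivatives.

Section BoxDerivatives.
Context {R : realType} {n : nat}.
Variables (a b : 'rV[R]_n).
Implicit Types (t : 'rV[R]_n).

Lemma cbox_dfilter_proper t i : a 0 i < b 0 i -> cbox a b t ->
  ProperFilter (dfilter (cbox a b) t (ebasis i)).
Proof.
move=> abi tab; apply: dfilter_proper => r r0.
have /andP[at_ tb] := tab i.
have hc (h : R) : a 0 i <= t 0 i + h <= b 0 i -> cbox a b (t + h *: ebasis i).
  by move=> hh; rewrite -updDe; apply: upd_cbox.
(* Below the upper face a positive increment stays in the box; on the upper face the increment must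
   be negative, and a < b leaves room for it. *)
have [ltb|leb] := ltP (t 0 i) (b 0 i).
  pose h := Num.min (r / 2) (b 0 i - t 0 i).
  have h0 : 0 < h by rewrite lt_min divr_gt0//= subr_gt0.
  have h1 : h <= r / 2 by rewrite ge_min lexx.
  have h2 : h <= b 0 i - t 0 i by rewrite ge_min lexx orbT.
  exists h; split; first by rewrite gtr0_norm// h0/=; lra.
  by apply: hc; apply/andP; split; lra.
pose h := Num.min (r / 2) (b 0 i - a 0 i).
have h0 : 0 < h by rewrite lt_min divr_gt0//= subr_gt0.
have h1 : h <= r / 2 by rewrite ge_min lexx.
have h2 : h <= b 0 i - a 0 i by rewrite ge_min lexx orbT.
exists (- h); split; first by rewrite normrN gtr0_norm// h0/=; lra.
by apply: hc; apply/andP; split; lra.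
Qed.

Lemma dquot_comp (N : nat) (k : 'I_N) (u : 'rV[R]_n -> 'rV[R]_N) t e
    (F : set_system R) (l : 'rV[R]_N) : Filter F ->
  dquot u t e @ F --> l -> dquot (Defs.comp k u) t e @ F --> l 0 k.
Proof.
move=> FF hu.
have -> : dquot (Defs.comp k u) t e = (fun v : 'rV[R]_N => v 0 k) \o dquot u t e.
  by apply/funext => h; rewrite /dquot /Defs.comp /= !mxE.
by apply: (cvg_comp _ _ hu); exact: coord_continuous.
Qed.

Lemma C1_on_comp (N : nat) (k : 'I_N) (u : 'rV[R]_n -> 'rV[R]_N) :
  (forall i, a 0 i < b 0 i) ->
  C1_on (cbox a b) (@tdirs R n) u -> C1_on (cbox a b) (@tdirs R n) (Defs.comp k u).
Proof.
move=> ab [cu du].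
have cproj (f : 'rV[R]_n -> 'rV[R]_N) : {within cbox a b, continuous f} ->
    {within cbox a b, continuous (fun t => f t 0 k)}.
  move=> cf x; have ck : {for f x, continuous (fun t : 'rV[R]_N => t 0 k)}.
    exact: coord_continuous.
  exact: (continuous_comp (cf x) ck).
split; first exact: cproj.
move=> _ [i _ <-]; have [d1 d2] := du _ (ex_intro2 _ _ i I erefl).
have key t : cbox a b t ->
    dquot (Defs.comp k u) t (ebasis i) @ dfilter (cbox a b) t (ebasis i)
      --> (dderiv_within (cbox a b) u t (ebasis i)) 0 k.
  move=> tab; have FF := cbox_dfilter_proper t i (ab i) tab.
  apply: dquot_comp; exact: d1.
split; first by move=> t /key h; apply/cvg_ex; eexists; exact: h.
apply: subspace_eq_continuous (cproj _ d2) => t; rewrite inE => tab.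
apply/esym; apply: dderiv_withinE; last exact: key.
exact: cbox_dfilter_proper.
Qed.

Lemma C1_on_lin (W : normedModType R) (f g : 'rV[R]_n -> W) (c : R) :
  (forall i, a 0 i < b 0 i) ->
  C1_on (cbox a b) (@tdirs R n) f -> C1_on (cbox a b) (@tdirs R n) g ->
  C1_on (cbox a b) (@tdirs R n) (fun t => f t + c *: g t) /\
  forall i t, cbox a b t ->
    dderiv_within (cbox a b) (fun t => f t + c *: g t) t (ebasis i) =
    dderiv_within (cbox a b) f t (ebasis i)
      + c *: dderiv_within (cbox a b) g t (ebasis i).
Proof.
move=> ab [cf df] [cg dg].
have key i t : cbox a b t ->
    dquot (fun t => f t + c *: g t) t (ebasis i)
      @ dfilter (cbox a b) t (ebasis i) -->
    dderiv_within (cbox a b) f t (ebasis i)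
      + c *: dderiv_within (cbox a b) g t (ebasis i).
  move=> tab; have e_i : @tdirs R n (ebasis i) by exists i.
  by apply: dquot_lin; [exact: (df _ e_i).1|exact: (dg _ e_i).1].
have keyE i t : cbox a b t ->
    dderiv_within (cbox a b) (fun t => f t + c *: g t) t (ebasis i) =
    dderiv_within (cbox a b) f t (ebasis i)
      + c *: dderiv_within (cbox a b) g t (ebasis i).
  move=> tab; apply: dderiv_withinE; last exact: key.
  exact: cbox_dfilter_proper.
split=> //; split.
  by move=> x; apply: cvgD; [exact: cf|apply: cvgZl_tmp; exact: cg].
move=> _ [i _ <-]; have e_i : @tdirs R n (ebasis i) by exists i.
split; first by move=> t /key h; apply/cvg_ex; eexists; exact: h.
apply: (@subspace_eq_continuous _ _ _
  (fun t => dderiv_within (cbox a b) f t (ebasis i)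
      + c *: dderiv_within (cbox a b) g t (ebasis i))).
  by move=> t; rewrite inE => tab; exact: (esym (keyE i t tab)).
by move=> x; apply: cvgD; [exact: (df _ e_i).2|apply: cvgZl_tmp; exact: (dg _ e_i).2].
Qed.

Lemma line_is_derive (f : 'rV[R]_n -> R) i t (l : R) :
  dquot f t (ebasis i) @ (0 : R)^' --> l ->
  is_derive (t 0 i) 1 (fun x : R => f (upd t i x)) l.
Proof.
move=> h.
have hE : (fun h : R => h^-1 *: (((fun x : R => f (upd t i x)) \o shift (t 0 i)) (h *: 1)
     - f (upd t i (t 0 i)))) = dquot f t (ebasis i).
  apply/funext => d; rewrite /dquot /= upd_id -updDe.
  by congr (_ *: (f (upd t i _) - _)); rewrite addrC; congr (_ + _); exact: mulr1.
apply: DeriveDef; first by rewrite /derivable hE; apply/cvg_ex; exists l.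
by rewrite /derive hE; apply: cvg_lim => //; exact: Rhausdorff.
Qed.

(** Only the i-th coordinate has to be interior. The increments leave the others fixed, so t may lie
    on other faces of the box and the derivative along the line is still two-sided. *)
Lemma tpartial_line_is_derive (f : 'rV[R]_n -> R) i t :
  (forall i, a 0 i < b 0 i) -> C1_on (cbox a b) (@tdirs R n) f -> cbox a b t ->
  a 0 i < t 0 i < b 0 i ->
  is_derive (t 0 i) 1 (fun x : R => f (upd t i x)) (tpartial a b i f t).
Proof.
move=> ab [_ df] tab /andP[h1 h2]; apply: line_is_derive.
have e_i : @tdirs R n (ebasis i) by exists i.
have [d1 _] := df _ e_i; apply: (@dfilter_dnbhs _ _ _ (cbox a b)); last exact: d1.
pose r := Num.min (t 0 i - a 0 i) (b 0 i - t 0 i).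
have r0 : 0 < r by rewrite lt_min !subr_gt0 h1.
apply/nbhs_ballP; exists r => //= h.
rewrite -ball_normE /ball_ /= sub0r normrN lt_min !ltr_norml.
move=> /andP[/andP[h3 h4] /andP[h5 h6]]; rewrite -updDe; apply: upd_cbox => //.
by rewrite in_itv/=; apply/andP; split; lra.
Qed.

End BoxDerivatives.

(** * Bump functions and the operator K on a box *)

Section Bump.
Context {R : realType} {n : nat}.
Variables (c : 'rV[R]_n) (r : R).
Implicit Types t : 'rV[R]_n.

Definition bump_rho t : R := r ^+ 2 - \sum_j (t 0 j - c 0 j) ^+ 2.
(** The function max(s, 0)^2 is C^1 across 0, with derivative 2 max(s, 0). The Euclidean ball on
    which [bump_rho] is positive lies in the cube of half-side r around c. *)
Definition bump_fn t : R := Num.max (bump_rho t) 0 ^+ 2.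
Definition dbump i t : R :=
  2 * Num.max (bump_rho t) 0 * (- 2 * (t 0 i - c 0 i)).

Lemma coordB_continuous j : continuous (fun t => t 0 j - c 0 j).
Proof.
move=> t; have cj : {for t, continuous (fun t : 'rV[R]_n => t 0 j)}.
  exact: coord_continuous.
exact: (cvgB cj (@cvg_cst _ (c 0 j) _ (nbhs t) _)).
Qed.

Lemma bump_rho_continuous : continuous bump_rho.
Proof.
have cs : continuous (fun t : 'rV[R]_n => \sum_j (t 0 j - c 0 j) ^+ 2).
  apply: (@sum_continuous R 'rV[R]_n 'I_n (index_enum _)
    (fun j t => (t 0 j - c 0 j) ^+ 2)) => j x.
  exact: (cvgM (coordB_continuous j x) (coordB_continuous j x)).
by move=> t; exact: (cvgB (@cvg_cst _ (r ^+ 2) _ (nbhs t) _) (cs t)).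
Qed.

Lemma bump_max_continuous : continuous (fun t => Num.max (bump_rho t) 0).
Proof.
move=> t; exact: (continuous_comp (bump_rho_continuous t)
  (max_cst_continuous 0 (bump_rho t))).
Qed.

Lemma bump_continuous : continuous bump_fn.
Proof.
move=> t; exact: (cvgM (bump_max_continuous t) (bump_max_continuous t)).
Qed.

Lemma dbump_continuous i : continuous (dbump i).
Proof.
move=> t; have cc (x : R) := @cvg_cst _ x _ (nbhs t) (nbhs_filter t).
have h1 := cvgM (cc 2) (bump_max_continuous t).
have h2 := cvgM (cc (- 2)) (coordB_continuous i t).
exact: (cvgM (h1 (nbhs_filter t)) (h2 (nbhs_filter t))).
Qed.

Lemma bump_ge0 t : 0 <= bump_fn t.
Proof. exact: sqr_ge0. Qed.

Lemma bump_center : 0 < r -> 0 < bump_fn c.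
Proof.
move=> r0; rewrite /bump_fn /bump_rho big1 ?subr0; last first.
  by move=> j _; rewrite subrr expr0n.
by rewrite max_l ?exprn_ge0 ?ltW// exprn_gt0// exprn_gt0.
Qed.

Lemma bump_rho_le0 t j : 0 < r -> r <= `|t 0 j - c 0 j| -> bump_rho t <= 0.
Proof.
move=> r0 h; rewrite subr_le0 (bigD1 j)//=.
rewrite (@le_trans _ _ ((t 0 j - c 0 j) ^+ 2))//.
  by rewrite -[leRHS]real_normK ?num_real// ler_pXn2r ?nnegrE// ltW.
by rewrite lerDl sumr_ge0// => i _; exact: sqr_ge0.
Qed.

Lemma bump_supp t j : 0 < r -> r <= `|t 0 j - c 0 j| ->
  bump_fn t = 0 /\ forall i, dbump i t = 0.
Proof.
move=> r0 h; have h0 := bump_rho_le0 t j r0 h.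
by rewrite /bump_fn /dbump max_r// expr0n; split=> // i; rewrite mulr0 mul0r.
Qed.

Lemma bump_rho_upd t i h : bump_rho (upd t i (t 0 i + h)) =
  bump_rho t + (- 2 * h * (t 0 i - c 0 i) - h ^+ 2).
Proof.
rewrite /bump_rho (bigD1 i)//= [in RHS](bigD1 i)//= updE eqxx.
rewrite (eq_bigr (fun j => (t 0 j - c 0 j) ^+ 2)); last first.
  by move=> j ji; rewrite updE (negbTE ji).
by ring.
Qed.

(** The derivative 2 max(s, 0) is 2-Lipschitz, which accounts for the remainder d^2. In each of the
    four sign cases the bound is a polynomial inequality. *)
Lemma sqr_max_taylor (s d : R) :
  `|Num.max (s + d) 0 ^+ 2 - Num.max s 0 ^+ 2 - 2 * Num.max s 0 * d| <= d ^+ 2.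
Proof.
rewrite ler_norml.
by case: (leP (s + d) 0) => h1; case: (leP s 0) => h2; apply/andP; split; nra.
Qed.

Lemma bump_dquot i t : dquot bump_fn t (ebasis i) @ (0 : R)^' --> dbump i t.
Proof.
apply/cvgrPdist_le => e e0.
pose m := Num.max (bump_rho t) 0; pose y := t 0 i - c 0 i.
have m0 : 0 <= m by rewrite le_max lexx orbT.
(* The increment of [bump_rho] is d = - h (2 y + h), so d^2 <= h^2 Q as soon as |h| <= 1. The error
   of the quotient is 2 m h minus the Taylor remainder divided by h, hence at most |h| (2 m + Q). *)
pose Q := (2 * `|y| + 1) ^+ 2.
have Q0 : 0 < Q by rewrite exprn_gt0// ltr_wpDl// mulr_ge0.
pose C := 2 * m + Q.
have C0 : 0 < C by rewrite ltr_wpDl// mulr_ge0.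
near=> h.
have h0 : h != 0 by near: h; exact: nbhs_dnbhs_neq.
have h1 : `|h| <= 1 by near: h; apply: dnbhs0_le.
have h2 : `|h| <= e / C by near: h; apply: dnbhs0_le; rewrite divr_gt0.
have hpos : 0 < `|h| by rewrite normr_gt0.
pose d := - 2 * h * y - h ^+ 2.
have := sqr_max_taylor (bump_rho t) d; rewrite -/m.
set rem := (X in `|X|) => hrem.
rewrite /dquot -updDe /bump_fn bump_rho_upd -/y -/d -/m.
have -> : dbump i t - h^-1 *: (Num.max (bump_rho t + d) 0 ^+ 2 - m ^+ 2) =
    2 * m * h - h^-1 * rem.
  rewrite /dbump -/m -/y /rem /GRing.scale/= /d; by field.
have nn : 0 <= 2 * `|y| + 1 by rewrite addr_ge0// mulr_ge0.
have hd : `|h|^-1 * d ^+ 2 <= `|h| * Q.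
  have -> : d = - h * (2 * y + h) by rewrite /d; ring.
  rewrite exprMn sqrrN -(real_normK (num_real h)) expr2 -mulrA mulKf ?gt_eqF//.
  rewrite ler_pM2l// -(real_normK (num_real (2 * y + h))) ler_pXn2r ?nnegrE ?nn//.
  by rewrite (le_trans (ler_normD _ _))// normrM ger0_norm// lerD2l.
rewrite (le_trans (ler_normB _ _))// normrM (ger0_norm (mulr_ge0 _ _))//.
rewrite normrM normrV ?unitfE//.
have : `|h|^-1 * `|rem| <= `|h|^-1 * d ^+ 2.
  by rewrite ler_wpM2l// invr_ge0.
have : `|h| * C <= e by rewrite -ler_pdivlMr.
rewrite /C; lra.
Unshelve. all: by end_near. Qed.

Variables (a b : 'rV[R]_n).

Lemma bump_C1 (W : normedModType R) (v : W) : (forall i, a 0 i < b 0 i) ->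
  C1_on (cbox a b) (@tdirs R n) (fun t => bump_fn t *: v).
Proof.
move=> ab; split.
  apply: continuous_subspaceT => t; exact: (cvgZr_tmp (a := v) (bump_continuous t)).
have key i t : dquot (fun t => bump_fn t *: v) t (ebasis i)
    @ dfilter (cbox a b) t (ebasis i) --> dbump i t *: v.
  have -> : dquot (fun t => bump_fn t *: v) t (ebasis i) =
      (fun h => dquot bump_fn t (ebasis i) h *: v).
    by apply/funext => h; rewrite /dquot -scalerBl scalerA.
  by apply: cvgZr_tmp; apply: dnbhs_dfilter; exact: bump_dquot.
move=> _ [i _ <-]; split.
  by move=> t _; apply/cvg_ex; eexists; exact: key.
apply: (@subspace_eq_continuous _ _ _ (fun t => dbump i t *: v)).
  move=> t; rewrite inE => tab; apply/esym; apply: dderiv_withinE; last exact: key.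
  exact: cbox_dfilter_proper.
apply: continuous_subspaceT => t; exact: (cvgZr_tmp (a := v) (dbump_continuous i t)).
Qed.

Lemma bump_C1_scalar : (forall i, a 0 i < b 0 i) ->
  C1_on (cbox a b) (@tdirs R n) bump_fn.
Proof.
move=> ab; have -> : bump_fn = (fun t => bump_fn t *: (1 : R)).
  by apply/funext => t; rewrite /GRing.scale/= mulr1.
exact: bump_C1.
Qed.

Lemma tpartial_bump i t : (forall i, a 0 i < b 0 i) -> cbox a b t ->
  tpartial a b i bump_fn t = dbump i t.
Proof.
move=> ab tab; apply: dderiv_withinE; first exact: cbox_dfilter_proper.
apply: dnbhs_dfilter; exact: bump_dquot.
Qed.

End Bump.

(** * The operator K on functions of the box: linearity, continuity, duality, integration by
    parts *)

Section KopBox.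
Context {R : realType} {n : nat}.
Notation mu := (@lebesgue_measure R).
Variables (a b : 'rV[R]_n).
Hypothesis ab : forall i, a 0 i < b 0 i.
Variables (kg : R -> R) (i : 'I_n).
Implicit Types (t : 'rV[R]_n) (f g : 'rV[R]_n -> R).

Lemma Kop_K1 p q f t : Kop kg a b i p q f t =
  K1 kg (a 0 i) (b 0 i) p q (fun y => f (upd t i y)) (t 0 i).
Proof. by []. Qed.

Lemma K1_ext (c d p q x : R) (f g : R -> R) : x \in `[c, d] ->
  (forall y, y \in `[c, d] -> f y = g y) ->
  K1 kg c d p q f x = K1 kg c d p q g x.
Proof.
rewrite in_itv/= => /andP[cx xd] fg; congr (_ * _ + _ * _).
  apply: eq_Rintegral => y; rewrite inE /= in_itv/= => /andP[h1 h2].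
  by rewrite fg// in_itv/= h1 (le_trans h2).
apply: eq_Rintegral => y; rewrite inE /= in_itv/= => /andP[h1 h2].
by rewrite fg// in_itv/= h2 (le_trans _ h1).
Qed.

Lemma cbox_itv t : cbox a b t -> t 0 i \in `[a 0 i, b 0 i].
Proof. by move=> tab; rewrite in_itv/=; exact: tab. Qed.

Lemma Kop_ext p q f g t : cbox a b t -> (forall t, cbox a b t -> f t = g t) ->
  Kop kg a b i p q f t = Kop kg a b i p q g t.
Proof.
move=> tab fg; rewrite !Kop_K1; apply: K1_ext; first exact: cbox_itv.
by move=> y hy; apply: fg; exact: upd_cbox.
Qed.

Lemma clamp_upd t y : cbox a b t -> y \in `[a 0 i, b 0 i] ->
  clamp a b (upd t i y) = upd t i y.
Proof. by move=> tab hy; apply: clamp_id; exact: upd_cbox. Qed.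

Lemma line_clamp_continuous (f : 'rV[R]_n -> R) t :
  {within cbox a b, continuous f} ->
  continuous (fun y : R => f (clamp a b (upd t i y))).
Proof.
move=> cf; apply: (upd_line_continuous i t (f \o clamp a b)).
exact: continuous_clamp.
Qed.

Hypothesis ki : mu.-integrable `]0, b 0 i - a 0 i[ (EFin \o kg).

Lemma Kop_lin p q (e : R) f g t : cbox a b t ->
  {within cbox a b, continuous f} -> {within cbox a b, continuous g} ->
  Kop kg a b i p q (fun t => f t + e * g t) t =
  Kop kg a b i p q f t + e * Kop kg a b i p q g t.
Proof.
move=> tab cf cg; rewrite !Kop_K1; have hx := cbox_itv t tab.
have E h : K1 kg (a 0 i) (b 0 i) p q (fun y => h (upd t i y)) (t 0 i) =
    K1 kg (a 0 i) (b 0 i) p q (fun y => h (clamp a b (upd t i y))) (t 0 i).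
  by apply: K1_ext => // y hy; rewrite clamp_upd.
rewrite (E (fun t => f t + e * g t)) (E f) (E g).
by rewrite (@K1_lin _ _ _ ki _ _ (lexx _))//; exact: line_clamp_continuous.
Qed.

(** Vanishing off the box makes [K1_conv] available on every line parallel to the i-th axis, which
    reduces the claim to an integral depending on a parameter. *)
Lemma Kop_supp_continuous p q f : continuous f ->
  (forall t, ~ cbox a b t -> f t = 0) ->
  {within cbox a b, continuous (Kop kg a b i p q f)}.
Proof.
move=> cf f0; set L := b 0 i - a 0 i.
(* All dependence on t, including that on the coordinates other than i, is in this jointly
   continuous factor. *)
pose H t (s : R) := f (upd t i (t 0 i - s)).
have cH : continuous (fun z : 'rV[R]_n * R => H z.1 z.2).
  move=> z; have cu : continuous (fun z : 'rV[R]_n * R => upd z.1 i (z.1 0 i - z.2)).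
    apply: upd_continuous => x; first exact: cvg_fst.
    apply: cvgB; last exact: cvg_snd.
    have cj : {for x.1, continuous (fun t : 'rV[R]_n => t 0 i)}.
      exact: coord_continuous.
    have cfst : {for x, continuous (fst : 'rV[R]_n * R -> 'rV[R]_n)}.
      exact: cvg_fst.
    exact: (continuous_comp cfst cj).
  exact: (continuous_comp (cu z) (cf _)).
have wi : mu.-integrable `[(- L), L] (EFin \o kappa kg L p q).
  by apply: (integrableS measurableT) => //; exact: kappa_integrable.
have := param_integral_continuous _ _ H (- L) L wi cH.
move=> /(@continuous_subspaceT _ _ (cbox a b)).
apply: subspace_eq_continuous => t; rewrite inE => tab; apply/esym.
rewrite [LHS](Kop_K1 p q f t) (@K1_conv _ _ L ki _ _ (lexx _))//.
- exact: upd_line_continuous.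
- move=> y hy; apply: f0 => /(_ i); rewrite updE eqxx => h.
  by move: hy; rewrite in_itv/= h.
- exact: cbox_itv.
Qed.

Lemma Int_Kop_dual p q f g t : cbox a b t ->
  {within cbox a b, continuous f} -> {within cbox a b, continuous g} ->
  Int a b i (fun t => g t * Kop kg a b i p q f t) t =
  Int a b i (fun t => f t * Kop kg a b i q p g t) t.
Proof.
move=> tab cf cg.
have E p' q' h (x : R) : x \in `[a 0 i, b 0 i] ->
    Kop kg a b i p' q' h (upd t i x) =
    K1 kg (a 0 i) (b 0 i) p' q' (fun y => h (clamp a b (upd t i y))) x.
  move=> hx; rewrite Kop_K1 updE eqxx.
  by apply: K1_ext => // y hy; rewrite clamp_upd// upd_upd.
have XY := @K1_dual _ _ _ ki _ _ (lexx _) p q _ _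
  (line_clamp_continuous f t cf) (line_clamp_continuous g t cg).
apply: etrans (etrans XY _); apply: eq_Rintegral => x; rewrite inE/= => hx.
  by rewrite (E _ _ _ _ hx) (clamp_upd _ _ tab hx).
by rewrite (E _ _ _ _ hx) (clamp_upd _ _ tab hx).
Qed.

(** The clamped line is defined on all of R, as a two-sided derivative demands, and near an interior
    x the clamp is the identity. *)
Lemma clamp_line_is_derive f t x : C1_on (cbox a b) (@tdirs R n) f ->
  cbox a b t -> x \in `]a 0 i, b 0 i[ ->
  is_derive x 1 (fun y : R => f (clamp a b (upd t i y)))
    (tpartial a b i f (clamp a b (upd t i x))).
Proof.
move=> df tab hx; have /andP[h1 h2] : a 0 i < x < b 0 i by move: hx; rewrite in_itv.
have hx' : x \in `[a 0 i, b 0 i] by rewrite in_itv/= !ltW.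
rewrite clamp_upd//.
have /= := @tpartial_line_is_derive R n a b f i (upd t i x) ab df
  (upd_cbox _ _ _ _ _ tab hx').
rewrite updE eqxx h1 h2 => /(_ isT).
apply: near_eq_is_derive.
near=> y; rewrite upd_upd clamp_upd// in_itv/=; apply/andP; split; apply: ltW.
  by near: y; exact: lt_nbhsr.
by near: y; exact: lt_nbhsl.
Unshelve. all: by end_near. Qed.

Lemma clamp_line_derivable f t : C1_on (cbox a b) (@tdirs R n) f ->
  cbox a b t ->
  derivable_oo_LRcontinuous (fun y : R => f (clamp a b (upd t i y)))
    (a 0 i) (b 0 i) /\
  {in `]a 0 i, b 0 i[, derive1 (fun y : R => f (clamp a b (upd t i y))) =1
     (fun x => tpartial a b i f (clamp a b (upd t i x)))}.
Proof.
move=> df tab; split; last first.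
  move=> x hx; rewrite derive1E.
  by have h := clamp_line_is_derive f t x df tab hx; rewrite derive_val.
have cl := line_clamp_continuous f t df.1; split.
- by move=> x hx; have := clamp_line_is_derive f t x df tab hx; case.
- exact/cvg_at_right_filter/cl.
- exact/cvg_at_left_filter/cl.
Qed.

(** The boundary terms disappear because f, later the bump, is zero on both faces; g, later the
    image of a derivative of F under K, is unconstrained there. *)
Lemma Int_by_parts f g t : C1_on (cbox a b) (@tdirs R n) f ->
  C1_on (cbox a b) (@tdirs R n) g -> cbox a b t ->
  f (upd t i (a 0 i)) = 0 -> f (upd t i (b 0 i)) = 0 ->
  Int a b i (fun t => f t * tpartial a b i g t) t =
  Int a b i (fun t => - (tpartial a b i f t * g t)) t.
Proof.
move=> df dg tab fa fb; have e_i : @tdirs R n (ebasis i) by exists i.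
have [F1 F2] := clamp_line_derivable f t df tab.
have [G1 G2] := clamp_line_derivable g t dg tab.
have cF := line_clamp_continuous (tpartial a b i f) t (df.2 _ e_i).2.
have cG := line_clamp_continuous (tpartial a b i g) t (dg.2 _ e_i).2.
have XY := Rintegration_by_parts (ab i) (continuous_subspaceT cF) F1 F2
  (continuous_subspaceT cG) G1 G2.
have ca : clamp a b (upd t i (a 0 i)) = upd t i (a 0 i).
  by rewrite clamp_upd// in_itv/= lexx (ltW (ab i)).
have cb : clamp a b (upd t i (b 0 i)) = upd t i (b 0 i).
  by rewrite clamp_upd// in_itv/= lexx (ltW (ab i)).
rewrite ca cb fa fb !mul0r subrr sub0r in XY.
transitivity (\int[mu]_(x in `[a 0 i, b 0 i])
    (f (clamp a b (upd t i x)) * tpartial a b i g (clamp a b (upd t i x)))).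
  by apply: eq_Rintegral => x; rewrite inE/= => hx; rewrite clamp_upd.
rewrite XY -mulN1r -RintegralZl//; last first.
  apply: continuous_integrable => x.
  exact: (cvgM (cF x) (line_clamp_continuous g t dg.1 x)).
by apply: eq_Rintegral => x; rewrite inE/= => hx; rewrite clamp_upd// mulN1r.
Qed.

End KopBox.

(** * First variation *)

Section FirstVariation.
Context {R : realType}.

(** A Heine-Cantor statement in which the second point may leave K while staying in D. This is the
    situation of the perturbed arguments of F: they remain in its domain but not in the image of the
    box under the unperturbed ones. *)
Lemma compact_uniform_within (V : normedModType R) (D K : set V) (g : V -> R)
    (d : R) : 0 < d -> compact K -> K `<=` D -> {within D, continuous g} ->
  exists2 r : R, 0 < r & forall z y, K z -> `|y| < r -> D (z + y) ->
    `|g (z + y) - g z| <= d.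
Proof.
move=> d0 /compact_near_coveringP/near_covering_withinP cK KD.
move=> /subspace_continuousP cg.
have H : \forall y \near (0 : V), K `<=`
    (fun z => D (z + y) -> `|g (z + y) - g z| <= d); last first.
  have /nbhs_ballP[r /= r0 hr] := H.
  exists r => // z y Kz yr; apply: (hr y) => //.
  by rewrite -ball_normE /ball_ /= sub0r normrN.
apply: (cK V (nbhs (0 : V))
  (fun y z => D (z + y) -> `|g (z + y) - g z| <= d)).
  move=> z0 Kz0; have d20 : 0 < d / 2 by rewrite divr_gt0.
  have := cg z0 (KD _ Kz0) => /cvgrPdist_lt/(_ _ d20)/nbhs_ballP[r /= r0 hr].
  have r20 : 0 < r / 2 by rewrite divr_gt0.
  exists (ball z0 (r / 2), ball (0 : V) (r / 2)) => /=.
    by split; exact: nbhsx_ballx.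
  move=> [z y] /= []; rewrite -!ball_normE /ball_ /= sub0r normrN.
  move=> h1 h2 Kz Dzy.
  have e1 : `|g z0 - g z| < d / 2.
    apply: hr; last exact: KD.
    by rewrite -ball_normE /ball_ /=; lra.
  have e2 : `|g z0 - g (z + y)| < d / 2.
    apply: hr => //; rewrite -ball_normE /ball_ /= opprD addrA.
    by rewrite (le_lt_trans (ler_normB _ _))//; lra.
  rewrite (le_trans (ler_distD (g z0) _ _))// distrC; lra.
Qed.

(** The whole line through z lies in D, so the derivative within D is an ordinary one along it. For
    [LagDom] this covers the directions x, v and w, which leave t fixed. *)
Lemma dderiv_mvt (V : normedModType R) (D : set V) (F : V -> R) (e : V) (z : V)
    (s : R) : (forall x : R, D (z + x *: e)) ->
  (forall z, D z -> dderivable_within D F z e) ->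
  exists2 x : R, `|x| <= `|s| &
    F (z + s *: e) - F z = s * dderiv_within D F (z + x *: e) e.
Proof.
move=> hD dF; pose phi x := F (z + x *: e).
have dphi (x : R) : is_derive x 1 phi (dderiv_within D F (z + x *: e) e).
  have hx : dquot F (z + x *: e) e @ (0 : R)^' -->
      dderiv_within D F (z + x *: e) e.
    apply: (@dfilter_dnbhs _ _ _ D); last exact: dF.
    by near=> h; rewrite -addrA -scalerDl.
  have hE : (fun h : R => h^-1 *: ((phi \o shift x) (h *: 1) - phi x)) =
      dquot F (z + x *: e) e.
    apply/funext => h; rewrite /dquot /phi /= -addrA -scalerDl.
    congr (_ *: (F (z + _ *: e) - _)); rewrite addrC; congr (_ + _).
    exact: mulr1.
  apply: DeriveDef; first by rewrite /derivable hE; apply/cvg_ex; eexists; exact: hx.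
  by rewrite /derive hE; apply: cvg_lim => //; exact: Rhausdorff.
have cphi (A : set R) : {within A, continuous phi}.
  apply: continuous_subspaceT => x; apply: differentiable_continuous.
  by apply/derivable1_diffP; case: (dphi x).
have phi0 : phi 0 = F z by rewrite /phi scale0r addr0.
have [s0|s0] := leP 0 s.
  have [x hx] := MVT_segment s0 (fun x _ => dphi x) (cphi _).
  rewrite phi0 subr0 mulrC => hE; exists x => //.
  by move: hx; rewrite in_itv/= => /andP[x0 xs]; rewrite !ger0_norm.
have [x hx] := MVT_segment (ltW s0) (fun x _ => dphi x) (cphi _).
rewrite phi0 sub0r mulrN => hE; exists x.
  by move: hx; rewrite in_itv/= => /andP[x0 xs]; rewrite !ler0_norm ?lerN2// ltW.
by rewrite -opprB hE opprK mulrC.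
Unshelve. all: by end_near. Qed.

(** The radius r does not depend on t. This uniformity lets the estimate be integrated over the box
    without any theorem on limits under the integral sign. *)
Lemma first_variation (V : normedModType R) (D : set V) (F : V -> R)
    (T J : Type) (A : set T) (z : T -> V) (K : set V)
    (l : seq J) (e : J -> V) (c : J -> T -> R) (M : R) (d : R) :
  (forall j x y, D y -> D (y + x *: e j)) ->
  (forall j y, D y -> dderivable_within D F y (e j)) ->
  (forall j, {within D, continuous (fun y => dderiv_within D F y (e j))}) ->
  compact K -> K `<=` D -> (forall t, A t -> K (z t)) ->
  0 <= M -> (forall j t, A t -> `|c j t| <= M) -> 0 < d ->
  exists2 r : R, 0 < r & forall (eps : R) t, `|eps| < r -> A t ->
    `|F (z t + eps *: \sum_(j <- l) c j t *: e j) - F (z t)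
      - eps * \sum_(j <- l) c j t * dderiv_within D F (z t) (e j)| <= d * `|eps|.
Proof.
move=> De dF cF cK KD AK M0 cM.
(* Move along one direction at a time, with a mean value theorem at each step. *)
elim: l d => [|j l IH] d d0.
  exists 1 => // eps t _ _; rewrite !big_nil scaler0 addr0 subrr mulr0 subr0.
  by rewrite normr0 mulr_ge0// ltW.
have d20 : 0 < d / 2 by rewrite divr_gt0.
have [r1 r10 h1] := IH _ d20.
have d30 : 0 < d / 2 / (M + 1) by rewrite divr_gt0// ltr_wpDl.
have [r2 r20 h2] := compact_uniform_within _ D K _ _ d30 cK KD (cF j).
(* [|eps| * Y] dominates the distance from z t to the mean value point: [|eps| * |y|] for the
   directions already added and at most [|eps| * M * |e j|] along e j. The + 1 keeps Y positive. *)
pose Y := \sum_(i <- l) M * `|e i| + M * `|e j| + 1.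
have Y0 : 0 < Y.
  by rewrite ltr_wpDl// addr_ge0 ?mulr_ge0// sumr_ge0// => i _; rewrite mulr_ge0.
exists (Num.min r1 (r2 / Y)); first by rewrite lt_min r10 divr_gt0.
move=> eps t; rewrite lt_min => /andP[er1 er2] At.
rewrite !big_cons; set y := \sum_(i <- l) c i t *: e i.
set S := \sum_(i <- l) _; have := h1 eps t er1 At; rewrite -/y -/S => hl.
have Dz : D (z t) by apply: KD; exact: AK.
have Dl (l' : seq J) : forall w, D w -> D (w + eps *: \sum_(i <- l') c i t *: e i).
  elim: l' => [|i l' IHl] w Dw; first by rewrite big_nil scaler0 addr0.
  rewrite big_cons scalerDr addrA; apply: IHl; rewrite scalerA; exact: De.
have Dzy : D (z t + eps *: y) by exact: Dl.
have [x hx mvt] := dderiv_mvt _ D F (e j) (z t + eps *: y) (eps * c j t)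
  (fun x => De _ _ _ Dzy) (dF j).
have -> : z t + eps *: (c j t *: e j + y) = z t + eps *: y + (eps * c j t) *: e j.
  by rewrite scalerDr scalerA [X in _ + X]addrC addrA.
set P := F _ in mvt *; set Q := F (z t + eps *: y) in mvt hl.
set g := dderiv_within D F (z t) (e j).
(* The step along e j is taken last, from z t + eps y; the rest is the increment covered by the
   induction hypothesis. *)
have -> : P - F (z t) - eps * (c j t * g + S) =
    (P - Q - eps * c j t * g) + (Q - F (z t) - eps * S) by ring.
rewrite mvt -mulrBr.
rewrite (le_trans (ler_normD _ _))//.
have hy : `|y| <= \sum_(i <- l) M * `|e i|.
  rewrite (le_trans (ler_norm_sum _ _ _))// ler_sum// => i _.
  by rewrite normrZ ler_wpM2r// cM.
have hsmall : `|eps *: y + x *: e j| < r2.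
  rewrite (le_lt_trans (ler_normD _ _))// !normrZ.
  have : `|x| * `|e j| <= `|eps| * (M * `|e j|).
    rewrite mulrA ler_wpM2r// (le_trans hx)// normrM ler_wpM2l//; exact: cM.
  have : `|eps| * `|y| <= `|eps| * \sum_(i <- l) M * `|e i| by rewrite ler_wpM2l.
  have : `|eps| * Y < r2 by rewrite -ltr_pdivlMr.
  rewrite /Y !mulrDr mulr1; have := normr_ge0 eps; lra.
have hg : `|dderiv_within D F (z t + eps *: y + x *: e j) (e j) - g|
    <= d / 2 / (M + 1).
  rewrite -addrA; apply: h2 => //; first exact: AK.
  by rewrite addrA; exact: De.
have : `|eps * c j t * (dderiv_within D F (z t + eps *: y + x *: e j) (e j) - g)|
    <= d / 2 * `|eps|.
  rewrite !normrM mulrC [`|eps| * _]mulrC mulrA ler_wpM2r//.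
  rewrite (@le_trans _ _ (d / 2 / (M + 1) * M))//.
    by rewrite ler_pM//; exact: cM.
  rewrite mulrAC ler_pdivrMr ?ltr_wpDl// ler_wpM2l// ?ltW//.
  by rewrite ltrDl.
lra.
Qed.

(** If m were nonzero, an error of at most half of |eps m| would give phi - phi 0 opposite strict
    signs at s and - s, against either kind of extremum. The factor v will be the volume of the
    box. *)
Lemma extremum_slope0 (phi : R -> R) (m v : R) : 0 <= v ->
  (forall d, 0 < d -> exists2 r : R, 0 < r & forall eps, `|eps| < r ->
     `|phi eps - phi 0 - eps * m| <= d * `|eps| * v) ->
  (forall eps, phi 0 <= phi eps) \/ (forall eps, phi eps <= phi 0) -> m = 0.
Proof.
move=> v0 hphi hext; apply/eqP/negP => /negP m0.
have m0' : 0 < `|m| by rewrite normr_gt0.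
have d0 : 0 < `|m| / 2 / (v + 1) by rewrite !divr_gt0// ltr_wpDl.
have [r r0 hr] := hphi _ d0.
have dv : `|m| / 2 / (v + 1) * v <= `|m| / 2.
  by rewrite mulrAC ler_pdivrMr ?ltr_wpDl// ler_wpM2l ?divr_ge0// lerDl.
have key (eps : R) : `|eps| < r -> `|phi eps - phi 0 - eps * m| <= `|m| / 2 * `|eps|.
  move=> /hr h; rewrite (le_trans h)// mulrAC ler_wpM2r//.
pose s := r / 2; have s0 : 0 < s by rewrite divr_gt0.
have h1 : `|s| < r by rewrite gtr0_norm// /s; lra.
have h2 : `|- s| < r by rewrite normrN.
have := key _ h1; have := key _ h2; rewrite normrN (gtr0_norm s0) !ler_norml.
move=> /andP[u1 u2] /andP[u3 u4].
have sm : 0 < s * `|m| by rewrite mulr_gt0.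
case: (leP 0 m) => ms.
  rewrite ger0_norm// in u1 u2 u3 u4 sm.
  by case: hext => h; have := h s; have := h (- s); nra.
rewrite ltr0_norm// in u1 u2 u3 u4 sm.
by case: hext => h; have := h s; have := h (- s); nra.
Qed.

End FirstVariation.

(** * The Euler-Lagrange equation *)

Lemma within_continuous_comp (T V W : topologicalType) (A : set T) (D : set V)
    (z : T -> V) (g : V -> W) : {within A, continuous z} ->
  (forall t, A t -> D (z t)) -> {within D, continuous g} ->
  {within A, continuous (fun t => g (z t))}.
Proof.
move=> /subspace_continuousP cz zD /subspace_continuousP cg.
apply/subspace_continuousP => t At.
apply: cvg_comp (cg _ (zD _ At)) => P hP.
have h := cz t At _ hP; rewrite /= /within /= in h *.
apply: (@filterS _ (nbhs t) _ _ _ _ h) => s /= hs As.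
by apply: hs => //; exact: zD.
Qed.

Section EulerLagrange.
Context {R : realType} {n N : nat}.
Notation mu := (@lebesgue_measure R).
Variables (a b alpha beta p1 q1 p2 q2 : 'rV[R]_n) (kern : R -> R -> R).
Variables (F : @LagT R n N -> R) (psi u : 'rV[R]_n -> 'rV[R]_N).
Hypothesis ab : forall i, a 0 i < b 0 i.
Hypothesis ka : forall i, mu.-integrable `]0, b 0 i - a 0 i[
  (EFin \o kern (1 - alpha 0 i)).
Hypothesis kb : forall i, mu.-integrable `]0, b 0 i - a 0 i[
  (EFin \o kern (beta 0 i)).
Hypothesis FC2 : C2_on (@LagDom R n N a b) (@Lagdirs R n N) F.

Local Notation adm := (admissible kern a b alpha beta p1 q1 p2 q2 psi).
Local Notation Phi := (Feval F kern a b alpha beta p1 q1 p2 q2).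
Local Notation J := (Jfun F kern a b alpha beta p1 q1 p2 q2).
Local Notation BB i := (Bop (kern (1 - alpha 0 i)) a b i (p1 0 i) (q1 0 i)).
Local Notation KK i := (Kop (kern (beta 0 i)) a b i (p2 0 i) (q2 0 i)).
Local Notation cont f := {within cbox a b, continuous f}.
Local Notation C1 f := (C1_on (cbox a b) (@tdirs R n) f).

Lemma Phi_continuous w : adm w -> cont (Phi w).
Proof.
move=> [[cw _] [cB [cK _]]].
have c1 : continuous (fun t : subspace (cbox a b) => t : 'rV[R]_n).
  exact: continuous_subspaceT (fun t => cvg_id).
have c3 : continuous (gradB kern a b alpha p1 q1 w : subspace (cbox a b) -> _).
  apply: mx_continuous => k i; have := cB k i.
  by apply: subspace_eq_continuous => t _; rewrite mxE.
have c4 : continuous (gradK kern a b beta p2 q2 w : subspace (cbox a b) -> _).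
  apply: mx_continuous => k i; have := cK k i.
  by apply: subspace_eq_continuous => t _; rewrite mxE.
have c12 := continuous_pair _ _ _ _ _ c1 cw.
exact: (continuous_pair _ _ _ _ _ (continuous_pair _ _ _ _ _ c12 c3) c4).
Qed.

Lemma Phi_dom w t : cbox a b t -> LagDom a b (Phi w t).
Proof. by []. Qed.

Lemma LagDom_shift (e : @LagT R n N) (x : R) z : e.1.1.1 = 0 ->
  LagDom a b z -> LagDom a b (z + x *: e).
Proof. by rewrite /LagDom /= => ->; rewrite scaler0 addr0. Qed.

Lemma Lag_comp_continuous w (e : @LagT R n N) : adm w -> Lagdirs e ->
  cont (fun t => dderiv_within (LagDom a b) F (Phi w t) e).
Proof.
move=> aw he; have [[_ dF] _] := FC2; have [_ cF] := dF e he.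
apply: (within_continuous_comp _ _ _ _ _ _ _ (Phi_continuous w aw) _ cF).
exact: Phi_dom.
Qed.

Lemma F_comp_continuous w : adm w -> cont (fun t => F (Phi w t)).
Proof.
move=> aw; have [[cF _] _] := FC2.
apply: (within_continuous_comp _ _ _ _ _ _ _ (Phi_continuous w aw) _ cF).
exact: Phi_dom.
Qed.

Lemma tpartial_continuous i (f : 'rV[R]_n -> R) : C1 f -> cont (tpartial a b i f).
Proof. by move=> [_ df]; have [] := df (ebasis i) (ex_intro2 _ _ i I erefl). Qed.

Lemma C1_on_linR (f g : 'rV[R]_n -> R) (c : R) : C1 f -> C1 g ->
  C1 (fun t => f t + c * g t) /\ forall i t, cbox a b t ->
    tpartial a b i (fun t => f t + c * g t) t =
    tpartial a b i f t + c * tpartial a b i g t.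
Proof. exact: (@C1_on_lin R n a b R). Qed.

Lemma Bop_lin i (f g : 'rV[R]_n -> R) (c : R) t : C1 f -> C1 g -> cbox a b t ->
  BB i (fun t => f t + c * g t) t = BB i f t + c * BB i g t.
Proof.
move=> df dg tab; rewrite /Bop -(Kop_lin _ _ ab _ _ (ka i))//; last 2 first.
  exact: tpartial_continuous.
  exact: tpartial_continuous.
by apply: Kop_ext => // s sab; have [_ ->] := C1_on_linR f g c df dg.
Qed.

(** * Perturbation of one component by a bump, and the vanishing of the first variation *)

Section BumpVariation.
Variables (c : 'rV[R]_n) (r : R) (k : 'I_N).
Hypothesis r0 : 0 < r.
Hypothesis supp : forall t : 'rV[R]_n, (forall j, `|t 0 j - c 0 j| < r) -> obox a b t.
Local Notation eta := (bump_fn c r).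
Hypothesis uadm : adm u.

Lemma eta_off t : ~ obox a b t -> eta t = 0 /\ forall i, dbump c r i t = 0.
Proof.
move=> tab; have [j hj] : exists j, r <= `|t 0 j - c 0 j|.
  apply: contrapT => /forallNP h; apply: tab; apply: supp => j.
  by rewrite ltNge; apply/negP; exact: h.
exact: bump_supp r0 hj.
Qed.

Lemma eta_off_cbox t : ~ cbox a b t -> eta t = 0 /\ forall i, dbump c r i t = 0.
Proof.
move=> tab; apply: eta_off => h; apply: tab => i.
by have /andP[h1 h2] := h i; rewrite !ltW.
Qed.

Let eta_C1 : C1 eta := bump_C1_scalar c r a b ab.

Lemma eta_cont : cont eta.
Proof. by case: eta_C1. Qed.

Lemma Beta_continuous i : cont (BB i eta).
Proof.
(* [tpartial] is under control at points of the box only, whereas [Kop_supp_continuous] asks for a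
   function continuous everywhere and zero off the box; [dbump] is one that agrees with it in the
   box. *)
apply: (@subspace_eq_continuous _ _ _ (Kop (kern (1 - alpha 0 i)) a b i
  (p1 0 i) (q1 0 i) (dbump c r i))).
  move=> t; rewrite inE => tab; apply: Kop_ext => // s sab.
  by rewrite tpartial_bump.
apply: Kop_supp_continuous; first exact: ka.
  exact: dbump_continuous.
by move=> t /eta_off_cbox[_].
Qed.

Lemma Keta_continuous i : cont (KK i eta).
Proof.
apply: Kop_supp_continuous; first exact: kb.
  exact: bump_continuous.
by move=> t /eta_off_cbox[].
Qed.

Definition var (eps : R) (t : 'rV[R]_n) : 'rV[R]_N :=
  u t + eps *: (eta t *: delta_mx 0 k).

(** The factor [(k' == k)%:R] treats the perturbed component and the unperturbed ones in a single
    formula. *)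
Lemma comp_var k' eps : Defs.comp k' (var eps) =
  (fun t => Defs.comp k' u t + (eps * (k' == k)%:R) * eta t).
Proof.
by apply/funext => t; rewrite /Defs.comp /var !mxE /= mulrA mulrAC.
Qed.

Lemma comp_C1 k' : C1 (Defs.comp k' u).
Proof. by apply: C1_on_comp => //; case: uadm. Qed.

Lemma Bop_var i k' eps t : cbox a b t ->
  BB i (Defs.comp k' (var eps)) t =
  BB i (Defs.comp k' u) t + (eps * (k' == k)%:R) * BB i eta t.
Proof.
by move=> tab; rewrite comp_var (Bop_lin i _ _ _ t (comp_C1 k') eta_C1 tab).
Qed.

Lemma Kop_var i k' eps t : cbox a b t ->
  KK i (Defs.comp k' (var eps)) t =
  KK i (Defs.comp k' u) t + (eps * (k' == k)%:R) * KK i eta t.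
Proof.
move=> tab; rewrite comp_var (Kop_lin _ _ ab _ _ (kb i))//.
  by case: (comp_C1 k').
exact: eta_cont.
Qed.

Lemma var_adm eps : adm (var eps).
Proof.
have [duC1 [cB [cK bd]]] := uadm.
have lin_cont (f g : 'rV[R]_n -> R) (x : R) : cont f -> cont g ->
    cont (fun t => f t + x * g t).
  move=> cf cg t; apply: cvgD; first exact: cf.
  by apply: cvgM; [exact: cvg_cst|exact: cg].
split; first by have [] := C1_on_lin a b _ u _ eps ab duC1
  (bump_C1 c r a b _ (delta_mx 0 k : 'rV[R]_N) ab).
split; [|split] => [k' i|k' i|t tab tob].
- have := lin_cont _ _ (eps * (k' == k)%:R) (cB k' i) (Beta_continuous i).
  apply: subspace_eq_continuous => t; rewrite inE => tab.
  by rewrite [RHS]Bop_var.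
- have := lin_cont _ _ (eps * (k' == k)%:R) (cK k' i) (Keta_continuous i).
  apply: subspace_eq_continuous => t; rewrite inE => tab.
  by rewrite [RHS]Kop_var.
- by rewrite /var (eta_off t tob).1 scale0r scaler0 addr0; exact: bd.
Qed.

Lemma var0 : var 0 = u.
Proof. by apply/funext => t; rewrite /var scale0r addr0. Qed.

(** One index for each of the 1 + 2n arguments of F that the perturbation moves, so that
    [first_variation] deals with a single sum. *)
Let Jidx := option ('I_n + 'I_n)%type.

Definition vdir (j : Jidx) : @LagT R n N :=
  match j with
  | None => dir_x n k
  | Some (inl i) => dir_v k i
  | Some (inr i) => dir_w k i
  end.

Definition vcoef (j : Jidx) : 'rV[R]_n -> R :=
  match j with
  | None => eta
  | Some (inl i) => BB i eta
  | Some (inr i) => KK i eta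
  end.

Definition vlist : seq Jidx :=
  None :: map (fun i => Some (inl i)) (enum 'I_n)
       ++ map (fun i => Some (inr i)) (enum 'I_n).

Lemma sum_vlist (A : zmodType) (G : Jidx -> A) : \sum_(j <- vlist) G j =
  G None + (\sum_i G (Some (inl i)) + \sum_i G (Some (inr i))).
Proof. by rewrite big_cons big_cat !big_map; congr (_ + (_ + _)). Qed.

Lemma sum_delta (x : 'I_n -> R) k' i' :
  (\sum_i x i *: (delta_mx k i : 'M[R]_(N, n))) k' i' = (k' == k)%:R * x i'.
Proof.
rewrite summxE (bigD1 i')//= big1 ?addr0.
  by rewrite !mxE eqxx andbT mulrC.
by move=> i /negbTE ii; rewrite !mxE [i' == i]eq_sym ii andbF mulr0.
Qed.

(** Linearity of K and B makes the argument of F exactly affine in eps, with coefficients that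
    depend on t and directions that do not. *)
Lemma Phi_var eps t : cbox a b t ->
  Phi (var eps) t = Phi u t + eps *: \sum_(j <- vlist) vcoef j t *: vdir j.
Proof.
move=> tab; rewrite sum_vlist /=.
have -> : \sum_i BB i eta t *: (dir_v k i : @LagT R n N) =
    (0, 0, \sum_i BB i eta t *: (delta_mx k i : 'M[R]_(N, n)), 0).
  apply: (big_ind2 (fun (x : @LagT R n N) (y : 'M[R]_(N, n)) => x = (0, 0, y, 0))).
  - by [].
  - by move=> x1 x2 y1 y2 -> ->; congr (_, _, _, _); rewrite addr0.
  - by move=> i _; congr (_, _, _, _); rewrite scaler0.
have -> : \sum_i KK i eta t *: (dir_w k i : @LagT R n N) =
    (0, 0, 0, \sum_i KK i eta t *: (delta_mx k i : 'M[R]_(N, n))).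
  apply: (big_ind2 (fun (x : @LagT R n N) (y : 'M[R]_(N, n)) => x = (0, 0, 0, y))).
  - by [].
  - by move=> x1 x2 y1 y2 -> ->; congr (_, _, _, _); rewrite addr0.
  - by move=> i _; congr (_, _, _, _); rewrite scaler0.
rewrite /Feval /dir_x; congr (_, _, _, _) => /=.
- by rewrite !scaler0 !addr0 scaler0 addr0.
- by rewrite !addr0.
- apply/matrixP => k' i'; rewrite !mxE Bop_var// ?mulr0 ?add0r ?addr0.
  by rewrite sum_delta mulrA.
- apply/matrixP => k' i'; rewrite !mxE Kop_var// ?mulr0 ?add0r ?addr0.
  by rewrite sum_delta mulrA.
Qed.

Lemma vdir_Lag j : Lagdirs (vdir j).
Proof.
case: j => [[i|i]|] /=.
- by right; right; left; exists k, i.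
- by right; right; right; exists k, i.
- by right; left; exists k.
Qed.

Lemma vdir_t j : (vdir j).1.1.1 = 0.
Proof. by case: j => [[i|i]|]. Qed.

Lemma vcoef_continuous j : cont (vcoef j).
Proof.
case: j => [[i|i]|] /=; [exact: Beta_continuous|exact: Keta_continuous|].
exact: eta_cont.
Qed.

Lemma cont_bounded (f : 'rV[R]_n -> R) : cont f ->
  exists2 M : R, 0 <= M & forall t, cbox a b t -> `|f t| <= M.
Proof.
move=> cf; have /compact_bounded[M [_ hM]] :=
  continuous_compact cf (cbox_compact a b).
exists (`|M| + 1); first by rewrite addr_ge0.
move=> t tab; apply: (hM (`|M| + 1)); last by exists t.
by rewrite (le_lt_trans (ler_norm _))// ltrDl.
Qed.

Lemma vcoef_bounded : exists2 M : R, 0 <= M &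
  forall j t, cbox a b t -> `|vcoef j t| <= M.
Proof.
have h j : exists M : R, 0 <= M /\ forall t, cbox a b t -> `|vcoef j t| <= M.
  by have [M M0 hM] := cont_bounded _ (vcoef_continuous j); exists M.
have [M hM] := choice h.
exists (\sum_j M j); first by apply: sumr_ge0 => j _; case: (hM j).
move=> j t tab; rewrite (le_trans ((hM j).2 t tab))// (bigD1 j)//= lerDl.
by apply: sumr_ge0 => i _; case: (hM i).
Qed.

(** The integrand of the derivative at eps = 0 of J along the perturbation. *)
Definition vgrad t : R := \sum_(j <- vlist)
  vcoef j t * dderiv_within (LagDom a b) F (Phi u t) (vdir j).

Lemma cont_mul (f g : 'rV[R]_n -> R) : cont f -> cont g ->
  cont (fun t => f t * g t).
Proof. by move=> cf cg t; apply: cvgM; [exact: cf|exact: cg]. Qed.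

Lemma vgrad_continuous : cont vgrad.
Proof.
apply: (@sum_continuous _ (subspace (cbox a b))) => j.
apply: cont_mul; first exact: vcoef_continuous.
by apply: Lag_comp_continuous => //; exact: vdir_Lag.
Qed.

Hypothesis uext : (forall w, adm w -> J u <= J w) \/ (forall w, adm w -> J w <= J u).

Lemma vgrad_iint0 : iint a b vgrad = 0.
Proof.
pose v := \prod_i (b 0 i - a 0 i).
have v0 : 0 <= v by apply: prodr_ge0 => i _; rewrite subr_ge0 ltW.
apply: (extremum_slope0 (fun eps => J (var eps)) _ v) => //; last first.
  by rewrite var0; case: uext => h; [left|right] => eps; apply: h; exact: var_adm.
move=> d d0; have [M M0 hM] := vcoef_bounded.
have cK := continuous_compact (Phi_continuous u uadm) (cbox_compact a b).
have [[cF dF] _] := FC2.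
have [|||||rr rr0 hrr] := @first_variation R _ (LagDom a b) F _ _ (cbox a b) (Phi u)
  (Phi u @` cbox a b) vlist vdir vcoef M d _ _ _ cK _ _ M0 hM d0.
- by move=> j x y; apply: LagDom_shift; exact: vdir_t.
- by move=> j y Dy; apply: (dF _ (vdir_Lag j)).1.
- by move=> j; apply: (dF _ (vdir_Lag j)).2.
- by move=> _ [t tab <-]; exact: Phi_dom.
- by move=> t tab; exists t.
exists rr => // eps er; rewrite var0 /Jfun.
have c1 := F_comp_continuous _ (var_adm eps).
have c2 := F_comp_continuous _ uadm.
have c3 : cont (fun t => F (Phi (var eps) t) + -1 * F (Phi u t)).
  move=> t; apply: cvgD; first exact: c1.
  by apply: cvgM; [exact: cvg_cst|exact: c2].
(* Collected under one integral, the error of J is bounded pointwise by [first_variation], and then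
   by that bound times the volume v. *)
have -> : iint a b (fun t => F (Phi (var eps) t)) - iint a b (fun t => F (Phi u t))
    - eps * iint a b vgrad =
    iint a b (fun t => (F (Phi (var eps) t) + -1 * F (Phi u t)) + (- eps) * vgrad t).
  rewrite (iint_lin _ _ ab _ (fun t => F (Phi (var eps) t) + -1 * F (Phi u t)))//.
    by rewrite (iint_lin _ _ ab)// mulN1r mulNr.
  exact: vgrad_continuous.
apply: iint_bound => //.
  move=> t; apply: cvgD; first exact: c3.
  by apply: cvgM; [exact: cvg_cst|exact: vgrad_continuous].
move=> t tab; rewrite mulN1r mulNr Phi_var//; exact: hrr.
Qed.

(** * Transfer of the operators from the bump to the derivatives of F *)

Local Notation Dx := (fun t => dxF a b F k (Phi u t)).
Local Notation Dv i := (fun t => dvF a b F k i (Phi u t)).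
Local Notation Dw i := (fun t => dwF a b F k i (Phi u t)).
Local Notation KB i := (Kop (kern (1 - alpha 0 i)) a b i (q1 0 i) (p1 0 i) (Dv i)).
Local Notation KW i := (Kop (kern (beta 0 i)) a b i (q2 0 i) (p2 0 i) (Dw i)).
Local Notation AB i := (Aop (kern (1 - alpha 0 i)) a b i (q1 0 i) (p1 0 i) (Dv i)).

Hypothesis KB_C1 : forall i, C1 (KB i).
Hypothesis KW_cont : forall i, cont (KW i).

Definition EL (t : 'rV[R]_n) : R := \sum_(i < n) (- AB i t + KW i t) + Dx t.

Lemma Dx_cont : cont Dx.
Proof. exact: Lag_comp_continuous uadm (vdir_Lag None). Qed.

Lemma Dv_cont i : cont (Dv i).
Proof. exact: Lag_comp_continuous uadm (vdir_Lag (Some (inl i))). Qed.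

Lemma Dw_cont i : cont (Dw i).
Proof. exact: Lag_comp_continuous uadm (vdir_Lag (Some (inr i))). Qed.

Lemma AB_cont i : cont (AB i).
Proof. exact: tpartial_continuous. Qed.

Lemma EL_cont : cont EL.
Proof.
have cs : cont (fun t => \sum_(i < n) (- AB i t + KW i t)).
  apply: (@sum_continuous _ (subspace (cbox a b))) => i t.
  exact: (cvgD (cvgN (AB_cont i t)) (KW_cont i t)).
by move=> t; exact: (cvgD (cs t) (Dx_cont t)).
Qed.

Lemma iint_Keta i : iint a b (fun t => KK i eta t * Dw i t) =
  iint a b (fun t => eta t * KW i t).
Proof.
transitivity (iint a b (fun t => Dw i t * KK i eta t)).
  by apply: iint_ext => t _; rewrite mulrC.
apply: (eq_iint_Int a b ab i).
- by apply: cont_mul; [exact: Dw_cont|exact: Keta_continuous].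
- by apply: cont_mul; [exact: eta_cont|exact: KW_cont].
by move=> t tab; exact: (Int_Kop_dual a b ab _ _ (kb i) _ _ eta (Dw i) t tab
  eta_cont (Dw_cont i)).
Qed.

Lemma iint_Beta i : iint a b (fun t => BB i eta t * Dv i t) =
  - iint a b (fun t => eta t * AB i t).
Proof.
have cdeta := tpartial_continuous i eta eta_C1.
have cKB : cont (KB i) by case: (KB_C1 i).
have cdK := cont_mul _ _ cdeta cKB.
have -> : iint a b (fun t => BB i eta t * Dv i t) =
    iint a b (fun t => tpartial a b i eta t * KB i t).
  transitivity (iint a b (fun t => Dv i t * BB i eta t)).
    by apply: iint_ext => t _; rewrite mulrC.
  apply: (eq_iint_Int a b ab i).
  - by apply: cont_mul; [exact: Dv_cont|exact: Beta_continuous].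
  - exact: cdK.
  by move=> t tab; exact: (Int_Kop_dual a b ab _ _ (ka i) _ _ (tpartial a b i eta)
    (Dv i) t tab cdeta (Dv_cont i)).
have -> : iint a b (fun t => eta t * AB i t) =
    iint a b (fun t => - (tpartial a b i eta t * KB i t)).
  apply: (eq_iint_Int a b ab i).
  - by apply: cont_mul; [exact: eta_cont|exact: AB_cont].
  - by move=> t; exact: (cvgN (cdK t)).
  (* Points with i-th coordinate a_i or b_i are outside the open box, so the bump vanishes there. *)
  move=> t tab; apply: (Int_by_parts a b ab i eta (KB i) t eta_C1 (KB_C1 i) tab).
    by apply: (eta_off _ _).1 => /(_ i); rewrite updE eqxx ltxx.
  by apply: (eta_off _ _).1 => /(_ i); rewrite updE eqxx ltxx andbF.
rewrite -[RHS]mulN1r -(iintZ _ _ ab)//; last by move=> t; exact: (cvgN (cdK t)).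
by apply: iint_ext => t _; rewrite mulN1r opprK.
Qed.

Lemma iint_eta_EL : iint a b (fun t => eta t * EL t) = 0.
Proof.
have cB i := cont_mul _ _ (Beta_continuous i) (Dv_cont i).
have cK i := cont_mul _ _ (Keta_continuous i) (Dw_cont i).
have cX := cont_mul _ _ eta_cont Dx_cont.
have cA i := cont_mul _ _ eta_cont (AB_cont i).
have cNA i : cont (fun t => -1 * (eta t * AB i t)).
  by apply: cont_mul; [move=> t; exact: cvg_cst|exact: cA].
have cW i := cont_mul _ _ eta_cont (KW_cont i).
have h1 : iint a b vgrad = iint a b (fun t => eta t * Dx t) +
    (\sum_i iint a b (fun t => BB i eta t * Dv i t) +
     \sum_i iint a b (fun t => KK i eta t * Dw i t)).
  apply: etrans _ (iint_addsum a b ab _ _ _ cX cB cK).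
  by apply: iint_ext => t _; rewrite /vgrad sum_vlist.
have h2 : iint a b (fun t => eta t * EL t) = iint a b (fun t => eta t * Dx t) +
    (\sum_i iint a b (fun t => -1 * (eta t * AB i t)) +
     \sum_i iint a b (fun t => eta t * KW i t)).
  apply: etrans _ (iint_addsum a b ab _ _ _ cX cNA cW).
  apply: iint_ext => t _; rewrite /EL mulrDr addrC; congr (_ + _).
  rewrite -big_split mulr_sumr; apply: eq_bigr => i _ /=.
  by rewrite mulrDr mulrN mulN1r.
rewrite h2 -[RHS]vgrad_iint0 h1; congr (_ + (_ + _)); apply: eq_bigr => i _.
  by rewrite (iintZ a b ab (-1) _ (cA i)) mulN1r iint_Beta.
by rewrite iint_Keta.
Qed.

End BumpVariation.
End EulerLagrange.

Lemma obox_near (R : realType) (n : nat) (a b t : 'rV[R]_n) : obox a b t ->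
  \forall s \near t, obox a b s.
Proof.
move=> tab; apply: (@filter_forall _ _
  (fun i (s : 'rV[R]_n) => a 0 i < s 0 i < b 0 i) (nbhs t) _) => i.
have /andP[h1 h2] := tab i.
have ci : {for t, continuous (fun s : 'rV[R]_n => s 0 i)}.
  exact: coord_continuous.
have h : \forall x \near (t 0 i), a 0 i < x < b 0 i.
  near=> x; apply/andP; split; near: x; [exact: lt_nbhsr|exact: lt_nbhsl].
exact: (ci _ h).
Unshelve. all: by end_near. Qed.

Theorem mainTheorem3 (R : realType) (n N : nat)
  (a b alpha beta p1 q1 p2 q2 : 'rV[R]_n)
  (kern : R -> R -> R)
  (F : @LagT R n N -> R)
  (psi u : 'rV[R]_n -> 'rV[R]_N) :
  (forall i, a 0 i < b 0 i) ->
  (forall i, 0 < alpha 0 i < 1) ->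
  (forall i, 0 < beta 0 i < 1) ->
  (forall i, lebesgue_measure.-integrable `]0, b 0 i - a 0 i[
                (EFin \o kern (1 - alpha 0 i))) ->
  (forall i, lebesgue_measure.-integrable `]0, b 0 i - a 0 i[
                (EFin \o kern (beta 0 i))) ->
  C2_on (@LagDom R n N a b) (@Lagdirs R n N) F ->
  admissible kern a b alpha beta p1 q1 p2 q2 psi u ->
  ((forall w, admissible kern a b alpha beta p1 q1 p2 q2 psi w ->
      Jfun F kern a b alpha beta p1 q1 p2 q2 u
        <= Jfun F kern a b alpha beta p1 q1 p2 q2 w) \/
   (forall w, admissible kern a b alpha beta p1 q1 p2 q2 psi w ->
      Jfun F kern a b alpha beta p1 q1 p2 q2 w
        <= Jfun F kern a b alpha beta p1 q1 p2 q2 u)) ->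
  (* regularity hypotheses (R); duals P* swap p and q *)
  (forall (k : 'I_N) (i : 'I_n),
     C1_on (cbox a b) (@tdirs R n)
       (Kop (kern (1 - alpha 0 i)) a b i (q1 0 i) (p1 0 i)
          (fun t => dvF a b F k i (Feval F kern a b alpha beta p1 q1 p2 q2 u t)))) ->
  (forall (k : 'I_N) (i : 'I_n),
     {within cbox a b, continuous
       (Kop (kern (beta 0 i)) a b i (q2 0 i) (p2 0 i)
          (fun t => dwF a b F k i (Feval F kern a b alpha beta p1 q1 p2 q2 u t)))}) ->
  forall (k : 'I_N) (t : 'rV[R]_n), obox a b t ->
    \sum_(i < n)
       (- Aop (kern (1 - alpha 0 i)) a b i (q1 0 i) (p1 0 i)
            (fun s => dvF a b F k i (Feval F kern a b alpha beta p1 q1 p2 q2 u s)) t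
        + Kop (kern (beta 0 i)) a b i (q2 0 i) (p2 0 i)
            (fun s => dwF a b F k i (Feval F kern a b alpha beta p1 q1 p2 q2 u s)) t)
    + dxF a b F k (Feval F kern a b alpha beta p1 q1 p2 q2 u t) = 0.
Proof.
move=> ab _ _ ka kb FC2 uadm uext KB_C1 KW_cont k t0 t0ab.
pose E := EL a b alpha beta p1 q1 p2 q2 kern F u k; rewrite -[LHS]/(E t0).
have cE : {within cbox a b, continuous E}.
  exact: (EL_cont _ _ _ _ _ _ _ _ _ _ psi).
have cEc := continuous_clamp _ _ _ _ ab cE.
apply/eqP/negP => /negP E0.
have t0c : clamp a b t0 = t0.
  by apply: clamp_id => i; have /andP[h1 h2] := t0ab i; rewrite !ltW.
(* Testing against E t0 * E rather than E treats both signs of E t0 at once. *)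
have EE0 : 0 < E t0 * E t0 by rewrite -expr2 exprn_even_gt0.
have cP : continuous (fun t => E t0 * (E \o clamp a b) t).
  by move=> t; exact: (cvgM (@cvg_cst _ (E t0) _ (nbhs t) _) (cEc t)).
have nearE : \forall t \near t0, 0 < E t0 * E (clamp a b t).
  have h : nbhs (E t0 * (E \o clamp a b) t0) [set x | 0 < x].
    by rewrite /= t0c; exact: lt_nbhsr.
  exact: (cP t0 _ h).
have nearO := obox_near _ _ _ _ _ t0ab.
have near2 : \forall t \near t0, 0 < E t0 * E (clamp a b t) /\ obox a b t.
  by near=> t; split; near: t.
have /nbhs_ballP[r /= r0 hr] := near2.
(* Balls of row vectors are taken coordinate by coordinate, so the cube that contains the support of
   the bump is the ball in which E keeps the sign of E t0. *)
have ballP (t : 'rV[R]_n) : (forall j, `|t 0 j - t0 0 j| < r) -> ball t0 r t.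
  by move=> ht; split=> // i j; rewrite -ball_normE /ball_ /= distrC !ord1.
have supp (t : 'rV[R]_n) : (forall j, `|t 0 j - t0 0 j| < r) -> obox a b t.
  by move=> /ballP/hr[].
have I0 := iint_eta_EL _ _ _ _ _ _ _ _ _ _ _ _ ab ka kb FC2 t0 r k r0 supp uadm
  uext (KB_C1 k) (KW_cont k).
(* The clamp inside H makes it continuous everywhere, as [iint_gt0] requires, without changing its
   integral over the box. *)
pose eta := bump_fn t0 r; pose H t := eta t * (E t0 * E (clamp a b t)).
have cH : continuous H.
  by move=> t; exact: (cvgM (bump_continuous t0 r t) (cP t)).
(* Inside the cube both factors are nonnegative; outside it the bump is zero, whatever the sign of
   the other factor. *)
have H0 t : 0 <= H t.
  have [ht|] := pselect (forall j, `|t 0 j - t0 0 j| < r).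
    have [h _] := hr _ (ballP _ ht).
    exact: (mulr_ge0 (bump_ge0 t0 r t) (ltW h)).
  move=> /existsNP[j /negP]; rewrite -leNgt => hj.
  by rewrite /H /eta (bump_supp _ _ _ _ r0 hj).1 mul0r.
have Ht0 : 0 < H t0 by rewrite /H t0c mulr_gt0//; exact: bump_center.
have := iint_gt0 a b H t0 cH H0 t0ab Ht0.
have ceta : {within cbox a b, continuous eta}.
  exact: continuous_subspaceT (bump_continuous t0 r).
have -> : iint a b H = E t0 * iint a b (fun t => eta t * E t).
  rewrite -(iintZ a b ab (E t0) _ (cont_mul _ _ _ _ ceta cE)).
  by apply: iint_ext => t tab; rewrite /H (clamp_id _ _ _ tab) mulrCA.
by rewrite I0 mulr0 ltxx.
Unshelve. all: by end_near. Qed.
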